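(* Let $A$ be a commutative ring such that $2=0$ in $A$, let $K$ be a subring of $A$, and let $n\ge 3$. If $H$ is a subgroup of $\mathrm{Sp}_{2n}(A)$ containing $\mathrm{Ep}_{2n}(K)$, then there is a unique form ring $(R,\Lambda)$ such that $K\subseteq\Lambda\subseteq R\subseteq A$ (with $R$ a subring of $A$) and $$\mathrm{Ep}_{2n}(R,\Lambda)\le H\le N_A(R,\Lambda),$$ where $N_A(R,\Lambda)$ is the normalizer of $\mathrm{Ep}_{2n}(R,\Lambda)$ in $\mathrm{Sp}_{2n}(A)$.
   Context: All rings are commutative with $1$, and subrings contain the same $1$. Symplectic group. Rows and columns of $2n\times 2n$ matrices are indexed by the ordered set $I=(1,\dots,n,-n,\dots,-1)$. Let $J$ be the $n\times n$ matrix with $1$ in each antidiagonal position and $0$ elsewhere, and $F=\begin{pmatrix}0&J\\-J&0\end{pmatrix}$. For a ring $R$, $\mathrm{Sp}_{2n}(R)=\{g\in \mathrm{GL}_{2n}(R)\mid g^{T}Fg=F\}$. Let $e$ be the identity matrix and $e_{ij}$ the matrix units. Root elements. The root system $C_n$ consists of the short roots $\pm\varepsilon_i\pm\varepsilon_j$ ($1\le i<j\le n$) and the long roots $\pm2\varepsilon_k$ ($1\le k\le n$), where $\varepsilon_1,\dots,\varepsilon_n$ is an orthonormal basis of Euclidean $n$-space. For $\xi\in R$ and $1\le i,j,k\le n$, $i\ne j$, the elementary root unipotents are $x_{\varepsilon_i-\varepsilon_j}(\xi)=e+\xi e_{ij}-\xi e_{-j,-i}$, $x_{\varepsilon_i+\varepsilon_j}(\xi)=e+\xi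 e_{i,-j}+\xi e_{j,-i}$, $x_{-\varepsilon_i-\varepsilon_j}(\xi)=e+\xi e_{-i,j}+\xi e_{-j,i}$, $x_{2\varepsilon_k}(\xi)=e+\xi e_{k,-k}$, $x_{-2\varepsilon_k}(\xi)=e+\xi e_{-k,k}$. Form rings. A (symplectic) form parameter in a ring $R$ is an additive subgroup $\Lambda$ of $R$ that contains $2R$ and satisfies $\xi^2\lambda\in\Lambda$ for all $\xi\in R$, $\lambda\in\Lambda$. A form ring is a pair $(R,\Lambda)$ of a ring $R$ and a form parameter $\Lambda$ in $R$. $\mathrm{Ep}_{2n}(R,\Lambda)$ is the subgroup of $\mathrm{Sp}_{2n}(R)$ generated by all $x_\alpha(\mu)$ with $\alpha$ short, $\mu\in R$, and all $x_\beta(\lambda)$ with $\beta$ long, $\lambda\in\Lambda$. $\mathrm{Ep}_{2n}(R)=\mathrm{Ep}_{2n}(R,R)$. *)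

(* Defs.v *)
From HB Require Import structures.
From mathcomp Require Import all_boot all_order all_algebra.
From mathcomp Require Import boolp classical_sets zify.

Set Implicit Arguments.
Unset Strict Implicit.
Unset Printing Implicit Defensive.

Import GRing.Theory.

Local Open Scope classical_set_scope.
Local Open Scope ring_scope.

(* Commutative rings are [comPzRingType]s, so that the zero ring is allowed.
   Subrings, form parameters and subgroups are arbitrary subsets, hence [set]s;
   [mem S] turns a set [S] into the predicate that [GRing.subring_closed],
   [GRing.zmod_closed] and [group_closed] expect. *)

(* The ordered index set (1, ..., n, -n, ..., -1) is ['I_(n + n)]. *)
Definition pidx n (i : 'I_n) : 'I_(n + n) := lshift n i.
Definition nidx n (i : 'I_n) : 'I_(n + n) := rshift n (rev_ord i).

Section SymplecticGroup.
Variables (A : comPzRingType) (n : nat).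

Definition antidiag_mx : 'M[A]_n := \matrix_(i, j) (j == rev_ord i)%:R.

Definition form_mx : 'M[A]_(n + n) := block_mx 0 antidiag_mx (- antidiag_mx) 0.

(* [unitmx] is not available over a [comPzRingType]. *)
Definition GLmx (g : 'M[A]_(n + n)) : Prop :=
  exists h : 'M[A]_(n + n), g *m h = 1%:M /\ h *m g = 1%:M.

Definition symplectic : pred 'M[A]_(n + n) :=
  [pred g | `[< GLmx g >] && (g^T *m form_mx *m g == form_mx)].

Record Sp : Type := MkSp { Sp_mx :> 'M[A]_(n + n); _ : symplectic Sp_mx }.

HB.instance Definition _ := [isSub for Sp_mx].
HB.instance Definition _ := [Choice of Sp by <:].

Lemma antidiag_mxK : antidiag_mx *m antidiag_mx = 1%:M.
Proof.
apply/matrixP=> i j; rewrite !mxE (bigD1 (rev_ord i)) //= big1 ?addr0.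
  by rewrite !mxE eqxx mul1r rev_ordK eq_sym.
by move=> k kNi; rewrite !mxE (negPf kNi) mul0r.
Qed.

Lemma form_mx_sqr : form_mx *m form_mx = - 1%:M.
Proof.
rewrite mulmx_block !mul0mx !mulmx0 mulNmx mulmxN antidiag_mxK !addr0 !add0r.
by rewrite scalar_mx_block opp_block_mx !oppr0.
Qed.

Lemma symplecticP (g : 'M[A]_(n + n)) :
  g^T *m form_mx *m g = form_mx -> symplectic g.
Proof.
move=> gF; rewrite /symplectic/= gF eqxx andbT; apply/asboolP.
have gl : (- form_mx *m g^T *m form_mx) *m g = 1%:M.
  by rewrite -!mulmxA (mulmxA g^T) gF mulNmx form_mx_sqr opprK.
by exists (- form_mx *m g^T *m form_mx); split=> //; apply: mulmx1C.
Qed.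

Lemma SpP (g : Sp) : g^T *m form_mx *m g = form_mx.
Proof. by case: g => g /= /andP[_ /eqP]. Qed.

Lemma Sp_one_subproof : symplectic 1%:M.
Proof. by apply: symplecticP; rewrite trmx1 mul1mx mulmx1. Qed.

Lemma Sp_mul_subproof (g h : Sp) : symplectic (g *m h).
Proof.
by apply: symplecticP; rewrite trmx_mul -!mulmxA (mulmxA _ g) (mulmxA _ _ h) (mulmxA g^T) SpP mulmxA SpP.
Qed.

Lemma Sp_invmxl (g : Sp) : (- form_mx *m g^T *m form_mx) *m g = 1%:M.
Proof. by rewrite -!mulmxA (mulmxA g^T) SpP mulNmx form_mx_sqr opprK. Qed.

Lemma Sp_inv_subproof (g : Sp) : symplectic (- form_mx *m g^T *m form_mx).
Proof.
set h := - _ *m _ *m _; have gh : g *m h = 1%:M.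
  exact/mulmx1C/Sp_invmxl.
apply: symplecticP; rewrite -[in LHS](SpP g) -!mulmxA gh mulmx1 !mulmxA.
by rewrite -trmx_mul gh trmx1 mul1mx.
Qed.

Definition Sp_one := MkSp Sp_one_subproof.
Definition Sp_mul (g h : Sp) := MkSp (Sp_mul_subproof g h).
(* F^-1 = - F, hence g^-1 = - F g^T F. *)
Definition Sp_inv (g : Sp) := MkSp (Sp_inv_subproof g).

Lemma Sp_mulA : associative Sp_mul.
Proof. by move=> x y z; apply/val_inj; rewrite /= mulmxA. Qed.
Lemma Sp_mul1 : left_id Sp_one Sp_mul.
Proof. by move=> x; apply/val_inj; rewrite /= mul1mx. Qed.
Lemma Sp_mul1r : right_id Sp_one Sp_mul.
Proof. by move=> x; apply/val_inj; rewrite /= mulmx1. Qed.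
Lemma Sp_mulV : left_inverse Sp_one Sp_inv Sp_mul.
Proof. by move=> x; apply/val_inj; rewrite /= Sp_invmxl. Qed.
Lemma Sp_mulrV : right_inverse Sp_one Sp_inv Sp_mul.
Proof. by move=> x; apply/val_inj/mulmx1C; rewrite /= Sp_invmxl. Qed.

HB.instance Definition _ :=
  isGroup.Build Sp Sp_mulA Sp_mul1 Sp_mul1r Sp_mulV Sp_mulrV.

End SymplecticGroup.

(* The root system C_n. [eps_add i j] and [eps_add j i] denote the same root
   (and likewise for [eps_addN]); their root elements coincide. *)
Variant Croot (n : nat) : Type :=
| eps_sub (i j : 'I_n) of i != j   (*   eps_i - eps_j *)
| eps_add (i j : 'I_n) of i != j   (*   eps_i + eps_j *)
| eps_addN (i j : 'I_n) of i != j  (* - eps_i - eps_j *)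
| eps_dbl (k : 'I_n)               (*   2 eps_k *)
| eps_dblN (k : 'I_n).             (* - 2 eps_k *)

Definition is_short n (a : Croot n) : bool :=
  match a with
  | eps_sub _ _ _ | eps_add _ _ _ | eps_addN _ _ _ => true
  | eps_dbl _ | eps_dblN _ => false
  end.

Definition is_long n (a : Croot n) : bool := ~~ is_short a.

Section RootElements.
Variables (A : comPzRingType) (n : nat).

Definition root_mx (a : Croot n) (xi : A) : 'M[A]_(n + n) :=
  match a with
  | eps_sub i j _ =>
      1%:M + xi *: delta_mx (pidx i) (pidx j) - xi *: delta_mx (nidx j) (nidx i)
  | eps_add i j _ =>
      1%:M + xi *: delta_mx (pidx i) (nidx j) + xi *: delta_mx (pidx j) (nidx i)
  | eps_addN i j _ =>
      1%:M + xi *: delta_mx (nidx i) (pidx j) + xi *: delta_mx (nidx j) (pidx i)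
  | eps_dbl k => 1%:M + xi *: delta_mx (pidx k) (nidx k)
  | eps_dblN k => 1%:M + xi *: delta_mx (nidx k) (pidx k)
  end.

Definition idx_sign (a : 'I_(n + n)) : A := if (a < n)%N then 1 else -1.

Lemma form_mxE (a b : 'I_(n + n)) :
  form_mx A n a b = if b == rev_ord a then idx_sign a else 0.
Proof.
have half (i : 'I_n) : (n + i < n)%N = false by rewrite ltnNge leq_addr.
rewrite /idx_sign; case: (split_ordP a) => i ->; case: (split_ordP b) => j ->;
  rewrite ?block_mxEul ?block_mxEur ?block_mxEdl ?block_mxEdr !mxE -!val_eqE /=
    ?half ?ltn_ord.
- case: eqP => // E; have := ltn_ord j; have := ltn_ord i; lia.
- have -> : (n + j == n + n - i.+1)%N = (j == n - i.+1 :> nat)%N.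
    by have := ltn_ord i; lia.
  by case: eqP.
- have -> : (j == n + n - (n + i).+1 :> nat)%N = (j == n - i.+1 :> nat)%N by lia.
  by case: eqP; rewrite ?oppr0.
- case: eqP => // E; have := ltn_ord j; have := ltn_ord i; lia.
Qed.

Lemma form_delta (a b : 'I_(n + n)) :
  form_mx A n *m delta_mx a b = idx_sign (rev_ord a) *: delta_mx (rev_ord a) b.
Proof.
apply/matrixP => c d; rewrite [LHS]mxE (bigD1 a) //= big1 ?addr0 => [|k /negPf ka].
  rewrite form_mxE !mxE eqxx /=.
  have -> : (a == rev_ord c) = (c == rev_ord a).
    by apply/eqP/eqP => ->; rewrite rev_ordK.
  by case: eqVneq => [->|]; rewrite ?mul0r ?mulr0.
by rewrite [X in _ * X]mxE ka mulr0.
Qed.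

Lemma delta_form (a b : 'I_(n + n)) :
  delta_mx a b *m form_mx A n = idx_sign b *: delta_mx a (rev_ord b).
Proof.
apply/matrixP => c d; rewrite [LHS]mxE (bigD1 b) //= big1 ?addr0 => [|k /negPf kb].
  by rewrite form_mxE !mxE eqxx andbT; case: (c == a); case: (d == _);
    rewrite ?(mul0r, mulr0, mul1r, mulr1).
by rewrite [X in X * _]mxE kb andbF mul0r.
Qed.

Lemma rev_pidx (i : 'I_n) : rev_ord (pidx i) = nidx i.
Proof. by apply/val_inj => /=; have := ltn_ord i; lia. Qed.
Lemma rev_nidx (i : 'I_n) : rev_ord (nidx i) = pidx i.
Proof. by rewrite -rev_pidx rev_ordK. Qed.
Lemma sgn_pidx (i : 'I_n) : idx_sign (pidx i) = 1.
Proof. by rewrite /idx_sign /= ltn_ord. Qed.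
Lemma sgn_nidx (i : 'I_n) : idx_sign (nidx i) = -1.
Proof. by rewrite /idx_sign /= ltnNge leq_addr. Qed.
Lemma pidx_eq (i j : 'I_n) : (pidx i == pidx j) = (i == j).
Proof. exact: (inj_eq (@lshift_inj _ _)). Qed.
Lemma nidx_eq (i j : 'I_n) : (nidx i == nidx j) = (i == j).
Proof. by rewrite -!rev_pidx (inj_eq rev_ord_inj) pidx_eq. Qed.
Lemma pnidx_eq (i j : 'I_n) : (pidx i == nidx j) = false.
Proof. by rewrite /pidx /nidx eq_lrshift. Qed.
Lemma npidx_eq (i j : 'I_n) : (nidx i == pidx j) = false.
Proof. by rewrite eq_sym pnidx_eq. Qed.

Lemma symplectic_add1 (x : 'M[A]_(n + n)) :
  form_mx A n *m x + x^T *m form_mx A n = 0 ->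
  x^T *m (form_mx A n *m x) = 0 -> symplectic (1%:M + x).
Proof.
move=> E1 E2; apply: symplecticP; rewrite [(_ + _)^T]raddfD /= trmx1 mulmxDl mul1mx.
by rewrite mulmxDr mulmx1 mulmxDl -mulmxA E2 addr0 -addrA (addrC (_^T *m _)) E1 addr0.
Qed.

Lemma root_mx_symplectic (a : Croot n) (xi : A) : symplectic (root_mx a xi).
Proof.
have trD (x y : 'M[A]_(n + n)) : (x + y)^T = x^T + y^T by exact: raddfD.
have trN (x : 'M[A]_(n + n)) : (- x)^T = - x^T by exact: raddfN.
have trZ (x : 'M[A]_(n + n)) : (xi *: x)^T = xi *: x^T by exact: linearZ.
have mul0 (b c d e : 'I_(n + n)) : (c == d) = false ->
    delta_mx b c *m delta_mx d e = 0 :> 'M[A]_(n + n).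
  by move=> cd; rewrite mul_delta_mx_0 ?cd.
have oppK (x y : 'M[A]_(n + n)) :
    (- x - y + (y + x) = 0) * (x + y + (- y - x) = 0).
  by rewrite -!opprD (addrC y) addNr subrr.
pose simp := (trD, trN, trZ, trmx_delta, mulmxDl, mulmxDr, mulmxN, mulNmx,
  =^~ scalemxAl, =^~ scalemxAr, form_delta, delta_form,
  rev_pidx, rev_nidx, sgn_pidx, sgn_nidx, scale1r, scaleN1r, scalerN, opprK).
have ijF (i j : 'I_n) : i != j -> ((i == j) = false) * ((j == i) = false).
  by move=> /negPf ij; split; rewrite // eq_sym.
case: a => [i j /ijF ij|i j /ijF ij|i j /ijF ij|k|k] /=; rewrite -?addrA;
  apply: symplectic_add1; rewrite !simp;
  rewrite ?mul0 ?(pidx_eq, nidx_eq, pnidx_eq, npidx_eq, ij) //;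
  rewrite ?(scaler0, oppr0, addr0) //; rewrite ?(addNr, addrN) //.
all: by rewrite ?pnidx_eq ?npidx_eq ?oppK.
Qed.

Definition root_elt (a : Croot n) (xi : A) : Sp A n :=
  MkSp (root_mx_symplectic a xi).

(* [Ep R L] is Ep_{2n}(R, L), viewed inside Sp_{2n}(A); Ep_{2n}(R) is
   [Ep R R]. *)
Definition Ep (R L : set A) : set (Sp A n) :=
  smallest (fun G => group_closed (mem G))
    ([set g | exists a mu, [/\ is_short a, R mu & g = root_elt a mu]] `|`
     [set g | exists b lam, [/\ is_long b, L lam & g = root_elt b lam]]).

End RootElements.

Arguments Ep {A} n R L.

Definition normalizer (G : groupType) (E : set G) : set G :=
  [set g | [set (h ^ g)%g | h in E] = E].

Section FormRings.
Variable A : comPzRingType.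

Definition is_subring (R : set A) : Prop := GRing.subring_closed (mem R).

Definition is_form_parameter (R L : set A) : Prop :=
  [/\ L `<=` R,
      GRing.zmod_closed (mem L),
      forall x, R x -> L (2%:R * x) &
      forall xi lam, R xi -> L lam -> L (xi ^+ 2 * lam)].

Definition is_form_ring (R L : set A) : Prop :=
  is_subring R /\ is_form_parameter R L.

End FormRings.

(* Main.v *)
Require Import Defs.
From mathcomp Require Import all_boot all_order all_algebra.
From mathcomp Require Import boolp classical_sets.
From Stdlib Require Import Ring.

Set Implicit Arguments.
Unset Strict Implicit.
Unset Printing Implicit Defensive.

Import GRing.Theory.

Local Open Scope classical_set_scope.
Local Open Scope ring_scope.

(** Over a ring with 2 = 0 a root element is determined by vectors rather than
    by matrix positions.  The long root elements and their conjugates are the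
    transvections T t v : w |-> w + t B(v,w) v, and the short ones are
    X u v : w |-> w + B(v,w) u + B(u,w) v with B(u,v) = 0.  An isometry g
    conjugates T t v into T t (g v) and X u v into X (g u) (g v), so the
    theorem becomes a statement about the columns of the matrices in H.

    Let R be the set of all xi with every x_alpha(xi), alpha short, in H and
    Lambda the set of all lambda with every x_beta(lambda), beta long, in H.
    Weyl group elements over F_2 and the commutator formula show that
    (R, Lambda) is a form ring ([coeffs_form_ring]); it is the largest one
    with Ep(R, Lambda) <= H.

    Normalization rests on one feature of characteristic 2: for a short root
    element g over F_2 one has B(v, g v) = 0, so T 1 v and T 1 (g v) commute.
    A second such step turns T 1 v into an element of a standard unipotent
    subgroup whose parameters are quadratic in the coordinates of v
    ([double_commutator], [vector_short]).  For a column v of a matrix in H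
    this shows that all products v_i v_j lie in R, that v_i^2 Lambda is
    contained in Lambda, and that q(v) lies in Lambda, where
    q(v) = sum_i v_i v_{-i} ([column_products], [column_squares],
    [column_qform]).  The coordinates themselves need not lie in R.

    Conversely, these three facts and a dual column w are enough to write
    T t v with t in Lambda as a product of root elements from Ep(R, Lambda).
    Since sum_i w_{-i} v_i = 1 and squaring is additive,
    sum_i w_{-i}^2 v_i^2 = 1, so that T t v is the product of the
    T (t w_{-i}^2) (v_i v), and each v_i v has coordinates in R.
    The T t (v_i v) differ by transformations X along the Koszul vectors
    v_{-j} e_i + v_{-i} e_j, which are orthogonal to v, from products of root
    elements and transvections along vectors with a vanishing hyperbolic pair
    of coordinates; all factors are elementary ([elem_T_spare],
    [elem_Y_koszul], [elem_T_column]).  Short root elements need no separate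
    treatment, because X u v = T 1 u T 1 v T 1 (u + v) and all three vectors
    are, up to scalars, columns of matrices in H ([short_conj_elem]).

    Uniqueness: Ep(R', Lambda') preserves R'-vectors and the form q modulo
    Lambda' ([Ep_form_unitary]).  If H normalizes it, then a commutator of a
    root element of H with one over F_2 lies in Ep(R', Lambda') and displays
    the parameter as a coordinate, or as a value of q. *)

Section CharacteristicTwo.
Variables (A : comPzRingType) (n : nat).
Hypothesis A2 : 2%:R = 0 :> A.

Local Notation I := 'I_(n + n).
Local Notation V := 'cV[A]_(n + n).
Local Notation M := 'M[A]_(n + n).

(** * Arithmetic when 2 = 0 *)

Lemma add2x (x : A) : x + x = 0.
Proof. by rewrite -mulr2n -mulr_natl A2 mul0r. Qed.

Lemma opp2 (x : A) : - x = x.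
Proof. by apply/eqP; rewrite -subr_eq0 -opprD add2x oppr0. Qed.

(* [ring] identifies atoms and operations syntactically; these names hide the
   structure instances, which vary from one occurrence to the next. *)
Let addA (x y : A) : A := x + y.
Let mulA (x y : A) : A := x * y.
Let zeroA : A := 0.
Let oneA : A := 1.
Let addE (x y : A) : x + y = addA x y. Proof. by []. Qed.
Let mulE (x y : A) : x * y = mulA x y. Proof. by []. Qed.
Let zeroE : 0 = zeroA. Proof. by []. Qed.
Let oneE : 1 = oneA. Proof. by []. Qed.

Let A_ring : ring_theory zeroA oneA addA mulA addA (fun x => x) (@eq A).
Proof.
split=> *; rewrite -?(addE, mulE, zeroE, oneE) ?add0r ?mul1r ?mulrA ?mulrDl ?addrA ?add2x //;
  first [exact: addrC | exact: mulrC].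
Qed.

(* Coefficients in F_2, encoded as [bool], let [ring] cancel equal terms. *)
Let A_of_bool (b : bool) : A := if b then oneA else zeroA.

Let A_morph :
  ring_morph zeroA oneA addA mulA addA id (@eq A)
    false true xorb andb xorb id Bool.eqb A_of_bool.
Proof.
split=> // [[] []|[] []|[] []|[] []] //=;
  by rewrite -?(addE, mulE, zeroE, oneE) ?(add2x, add0r, addr0, mul0r, mulr0, mul1r).
Qed.

Add Ring A_ring : A_ring (morphism A_morph).

Ltac ring2 :=
  rewrite ?expr2; rewrite ?(opp2, addE, mulE, zeroE, oneE);
  match goal with |- @eq _ ?l ?r => change (@eq (GRing.ComPzRing.sort A) l r) end; ring.

(** A constant of its own, so that [ring2] sees the same atom for the same
    coordinate. *)
Definition crd (v : V) (i : I) : A := v i 0.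
Local Notation "v .@ i" := (crd v i) (at level 2, left associativity, format "v .@ i").
Local Notation s := (@rev_ord (n + n)).

Lemma vecP (u v : V) : (forall i, u.@i = v.@i) -> u = v.
Proof. by move=> E; apply/colP => i; apply: E. Qed.

Lemma crdD (u v : V) i : (u + v).@i = u.@i + v.@i. Proof. by rewrite /crd mxE. Qed.
Lemma crdZ c (v : V) i : (c *: v).@i = c * v.@i. Proof. by rewrite /crd mxE. Qed.
Lemma crd0 i : (0 : V).@i = 0. Proof. by rewrite /crd mxE. Qed.
Lemma crd_sum J (r : seq J) (P : pred J) (F : J -> V) i :
  (\sum_(j <- r | P j) F j).@i = \sum_(j <- r | P j) (F j).@i.
Proof. by rewrite /crd summxE. Qed.

(** * The alternating form and its quadratic refinement *)

Definition unit_vec (a : I) : V := delta_mx a 0.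
Local Notation e := unit_vec.

Lemma crd_e a i : (e a).@i = (i == a)%:R.
Proof. by rewrite /crd mxE eqxx andbT. Qed.

Lemma vec_sum (v : V) : v = \sum_i v.@i *: e i.
Proof.
apply: vecP => i; rewrite crd_sum (bigD1 i) //= big1 ?addr0 => [|j ji].
  by rewrite crdZ crd_e eqxx mulr1.
by rewrite crdZ crd_e eq_sym (negPf ji) mulr0.
Qed.

Lemma add2v (v : V) : v + v = 0.
Proof. by apply: vecP => i; rewrite crdD crd0 add2x. Qed.

Definition bform (u v : V) : A := \sum_i u.@i * v.@(s i).
Local Notation B := bform.

Lemma BDl u v w : B (u + v) w = B u w + B v w.
Proof. by rewrite -big_split; apply: eq_bigr => i _; rewrite crdD mulrDl. Qed.
Lemma BDr u v w : B u (v + w) = B u v + B u w.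
Proof. by rewrite -big_split; apply: eq_bigr => i _; rewrite crdD mulrDr. Qed.
Lemma BZl c u v : B (c *: u) v = c * B u v.
Proof. by rewrite mulr_sumr; apply: eq_bigr => i _; rewrite crdZ mulrA. Qed.
Lemma BZr c u v : B u (c *: v) = c * B u v.
Proof. by rewrite mulr_sumr; apply: eq_bigr => i _; rewrite crdZ mulrCA. Qed.
Lemma BC u v : B u v = B v u.
Proof.
rewrite /B (reindex_inj rev_ord_inj); apply: eq_bigr => i _.
by rewrite rev_ordK mulrC.
Qed.
Lemma B0l v : B 0 v = 0.
Proof. by rewrite -(scale0r (0 : V)) BZl mul0r. Qed.
Lemma B0r v : B v 0 = 0.
Proof. by rewrite BC B0l. Qed.
Lemma Be a v : B (e a) v = v.@(s a).
Proof.
rewrite /B (bigD1 a) //= big1 ?addr0 => [|i ia]; first by rewrite crd_e eqxx mul1r.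
by rewrite crd_e (negPf ia) mul0r.
Qed.

Lemma sum_pairs (F : I -> A) :
  \sum_i F i = \sum_(i < n) (F (pidx i) + F (nidx i)).
Proof.
rewrite big_split_ord big_split /=; congr (_ + _).
by rewrite (reindex_inj rev_ord_inj).
Qed.

(** A quadratic form with polar form [bform].  Isometries of [bform] need not
    preserve it; the form parameter measures by how much they may change it. *)
Definition qform (v : V) : A := \sum_(i < n) v.@(pidx i) * v.@(nidx i).
Local Notation q := qform.

Lemma Bvv v : B v v = 0.
Proof.
rewrite /B sum_pairs big1 // => i _; rewrite rev_pidx rev_nidx; ring2.
Qed.

Lemma qD u v : q (u + v) = q u + q v + B u v.
Proof.
rewrite /B sum_pairs -!big_split; apply: eq_bigr => i _ /=.
rewrite rev_pidx rev_nidx !crdD; ring2.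
Qed.
Lemma qZ c v : q (c *: v) = c ^+ 2 * q v.
Proof.
rewrite mulr_sumr; apply: eq_bigr => i _; rewrite !crdZ; ring2.
Qed.
Lemma q0 : q 0 = 0.
Proof. by rewrite -(scale0r (0 : V)) qZ expr0n mul0r. Qed.

Lemma qe a : q (e a) = 0.
Proof.
rewrite /q big1 // => i _; rewrite !crd_e.
case: eqP => [<-|]; last by rewrite mul0r.
by rewrite npidx_eq mulr0.
Qed.

Lemma s_neq a : (s a == a) = false.
Proof.
have [i ->|i ->] := split_ordP a.
  by rewrite -/(pidx i) rev_pidx npidx_eq.
by rewrite -[i]rev_ordK -/(nidx _) rev_nidx pnidx_eq.
Qed.

(** The indices lie in different pairs {i, -i}, so that [e a] and [e b] span a
    totally isotropic plane.  These pairs index the short roots. *)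
Definition indep (a b : I) := (b != a) && (b != s a).

Lemma indepsl a b : indep (s a) b = indep a b.
Proof. by rewrite /indep rev_ordK andbC. Qed.
Lemma indepC a b : indep a b = indep b a.
Proof.
rewrite /indep eq_sym; congr (_ && ~~ _).
by rewrite -(inj_eq rev_ord_inj) rev_ordK eq_sym.
Qed.
Lemma indepsr a b : indep a (s b) = indep a b.
Proof. by rewrite indepC indepsl indepC. Qed.

(** * Transvections and short transformations *)

Definition outer (u v : V) : M := \matrix_(i, j) (u.@i * v.@(s j)).

Lemma mul_outer u v (w : V) : outer u v *m w = B v w *: u.
Proof.
apply: vecP => i; rewrite crdZ /crd mxE [B v w]BC mulr_suml; apply: eq_bigr => j _.
rewrite mxE -/(crd w j) -/(crd u i); ring2.
Qed.

Lemma mxvP (g h : M) : (forall w : V, g *m w = h *m w) -> g = h.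
Proof.
move=> E; apply/matrixP => i j.
by have /matrixP/(_ i 0) := E (e j); rewrite -!colE !mxE.
Qed.

Definition transvection t v : M := 1%:M + t *: outer v v.
Local Notation T := transvection.

Definition short_transformation u v : M := 1%:M + (outer u v + outer v u).
Local Notation X := short_transformation.

Lemma Tv t v (w : V) : T t v *m w = w + (t * B v w) *: v.
Proof. by rewrite mulmxDl mul1mx -scalemxAl mul_outer scalerA. Qed.

Lemma Xv u v (w : V) : X u v *m w = w + B v w *: u + B u w *: v.
Proof. by rewrite !mulmxDl mul1mx !mul_outer addrA. Qed.

Lemma XC u v : X u v = X v u.
Proof. by rewrite /X [outer u v + _]addrC. Qed.

Ltac vec2 := apply: vecP => ?; rewrite ?(crdD, crdZ, crd0, BDl, BDr, BZl, BZr, Bvv); ring2.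

Lemma XZ c u v : X (c *: u) v = X u (c *: v).
Proof. by apply: mxvP => w; rewrite !Xv; vec2. Qed.

Lemma Xvv c v : X v (c *: v) = 1%:M.
Proof. by apply: mxvP => w; rewrite !Xv mul1mx; vec2. Qed.

Lemma TZ t c v : T t (c *: v) = T (t * c ^+ 2) v.
Proof. by apply: mxvP => w; rewrite !Tv; vec2. Qed.

Lemma T0 v : T 0 v = 1%:M.
Proof. by apply: mxvP => w; rewrite !Tv mul1mx; vec2. Qed.

Lemma TD t t' v : T (t + t') v = T t v *m T t' v.
Proof. by apply: mxvP => w; rewrite -mulmxA !Tv; vec2. Qed.

Lemma TT t v : T t v *m T t v = 1%:M.
Proof. by rewrite -TD add2x T0. Qed.

Lemma T_add t u v : B u v = 0 -> T t (u + v) = T t u *m T t v *m X u (t *: v).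
Proof.
move=> uv; apply: mxvP => w.
rewrite -!mulmxA !(Tv, Xv) !(BDr, BDl, BZr, BZl) ![B v u]BC !uv; vec2.
Qed.

Lemma X_add u v v' : B u v = 0 -> B u v' = 0 ->
  X u (v + v') *m T (B v v') u = X u v *m X u v'.
Proof.
move=> uv uv'; apply: mxvP => w.
rewrite -!mulmxA !(Tv, Xv) !(BDr, BDl, BZr, BZl) [B v u]BC [B v' u]BC !uv !uv' Bvv; vec2.
Qed.

Lemma XX u v : B u v = 0 -> X u v *m X u v = 1%:M.
Proof. by move=> uv; rewrite -X_add // add2v Bvv T0 mulmx1 -(scale0r u) Xvv. Qed.

(** The Eichler-Siegel transformation of q along u.  The factor T (q r) u
    absorbs the defect B(v,v') of additivity in [X_add], so that Y u is additive
    on the orthogonal complement of u, which X u is not. *)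
Definition siegel u r : M := X u r *m T (q r) u.
Local Notation Y := siegel.

Lemma Yv u r (w : V) : B u r = 0 ->
  Y u r *m w = w + B r w *: u + B u w *: r + (q r * B u w) *: u.
Proof.
by move=> ur; rewrite /Y -mulmxA Tv Xv !(BDr, BZr) [B r u]BC ur Bvv; vec2.
Qed.

Lemma YD u r r' : B u r = 0 -> B u r' = 0 -> Y u (r + r') = Y u r *m Y u r'.
Proof.
move=> ur ur'; apply: mxvP => w.
rewrite -mulmxA !Yv ?BDr ?ur ?ur' ?addr0 //.
rewrite qD !(BDr, BDl, BZr, BZl) [B r u]BC !ur !ur' Bvv; vec2.
Qed.

Lemma Y0 u : Y u 0 = 1%:M.
Proof. by apply: mxvP => w; rewrite Yv ?B0r // q0 mul1mx B0l; vec2. Qed.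

Lemma Y_isotropic u r : q r = 0 -> Y u r = X u r.
Proof. by move=> qr; rewrite /Y qr T0 mulmx1. Qed.

Definition isometry (g : M) := forall u v : V, B (g *m u) (g *m v) = B u v.

Lemma isometry_T g t v : isometry g -> g *m T t v = T t (g *m v) *m g.
Proof.
move=> gB; apply: mxvP => w; rewrite -!mulmxA !Tv gB mulmxDr.
by rewrite -scalemxAr.
Qed.

Lemma isometry_X g u v : isometry g -> g *m X u v = X (g *m u) (g *m v) *m g.
Proof.
move=> gB; apply: mxvP => w; rewrite -!mulmxA !Xv !gB !mulmxDr.
by rewrite -!scalemxAr.
Qed.

Lemma X_isometry u v : B u v = 0 -> isometry (X u v).
Proof.
move=> uv w w'; rewrite !Xv !(BDr, BDl, BZr, BZl) [B v u]BC !uv !Bvv.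
rewrite ![B w _]BC; ring2.
Qed.

Lemma X_conj_T u v t w : B u v = 0 -> X u v *m T t w *m X u v = T t (X u v *m w).
Proof.
by move=> uv; rewrite (isometry_T _ _ (X_isometry uv)) -mulmxA XX // mulmx1.
Qed.

Lemma X_conj_X u v w w' : B u v = 0 ->
  X u v *m X w w' *m X u v = X (X u v *m w) (X u v *m w').
Proof.
by move=> uv; rewrite (isometry_X _ _ (X_isometry uv)) -mulmxA XX // mulmx1.
Qed.

(** * Koszul vectors and products of root elements *)

(** The source of the bound n >= 3: the commutator arguments below pass through
    a coordinate pair away from two given ones. *)
Lemma third_index (n_ge3 : (3 <= n)%N) (i j : I) :
  exists c : I, indep i c /\ indep j c.
Proof.
have cls (k : I) : exists k' : 'I_n, forall c, c != k' -> pidx c != k /\ pidx c != s k.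
  have [k' ->|k' ->] := split_ordP k; [exists k' | exists (rev_ord k')] => c ck.
    by rewrite -/(pidx k') rev_pidx pidx_eq pnidx_eq.
  by rewrite -[k']rev_ordK -/(nidx _) rev_nidx pidx_eq pnidx_eq.
have [i' Hi] := cls i; have [j' Hj] := cls j.
have : (0 < #|predC (pred2 i' j')|)%N.
  rewrite -(ltn_add2l #|pred2 i' j'|) addn0 cardC card2 card_ord.
  by apply: leq_ltn_trans n_ge3; case: (_ != _).
case/card_gt0P => c; rewrite !inE negb_or => /andP[ci cj].
exists (pidx c); have [? ?] := Hi c ci; have [? ?] := Hj c cj.
by split; apply/andP.
Qed.

(** The closure that a group generated by involutions has; here every root
    element is one. *)
Definition mul_stable (P : M -> Prop) :=
  P 1%:M /\ forall g h, P g -> P h -> P (g *m h).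

Lemma Y_sum P u J (r : seq J) (F : J -> V) (p : pred J) : mul_stable P ->
  (forall j, p j -> B u (F j) = 0 /\ P (Y u (F j))) -> P (Y u (\sum_(j <- r | p j) F j)).
Proof.
move=> [P1 PM] PF.
suff [] : B u (\sum_(j <- r | p j) F j) = 0 /\ P (Y u (\sum_(j <- r | p j) F j)) by [].
apply: (big_ind (fun x => B u x = 0 /\ P (Y u x))) => //; first by rewrite B0r Y0.
by move=> x y [ux Px] [uy Py]; rewrite BDr ux uy addr0 YD //; split=> //; apply: PM.
Qed.

(** The displacement of v by the root element X (e i) (e j).  These are the
    Koszul syzygies of the coordinates of v: they are orthogonal to v, and they
    span its orthogonal complement when v is unimodular. *)
Definition koszul v i j : V := v.@(s j) *: e i + v.@(s i) *: e j.

Lemma B_koszul v i j w : B (koszul v i j) w = v.@(s j) * w.@(s i) + v.@(s i) * w.@(s j).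
Proof. by rewrite BDl !BZl !Be. Qed.

Lemma q_koszul v i j : indep i j -> q (koszul v i j) = 0.
Proof.
by move=> /andP[_ ji]; rewrite qD !qZ !qe BZl BZr Be crd_e eq_sym (negPf ji) !mulr0 !addr0.
Qed.

Lemma B_koszul_self v i j : B (koszul v i j) v = 0.
Proof. by rewrite B_koszul; ring2. Qed.

Section FormRing.
Variables R L : set A.
Hypothesis RL : is_form_ring R L.

Lemma form_ring1 : R 1.
Proof. by case: RL => [[]]; rewrite inE. Qed.
Lemma form_ringM x y : R x -> R y -> R (x * y).
Proof. by case: RL => [[_ _ RM] _] Rx Ry; have := RM x y; rewrite !inE; apply. Qed.
Lemma form_ringD x y : R x -> R y -> R (x + y).
Proof. by case: RL => [[_ RB _] _] Rx Ry; have := RB x y; rewrite !inE opp2; apply. Qed.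
Lemma form_ring0 : R 0.
Proof. by rewrite -(add2x 1); apply: form_ringD; apply: form_ring1. Qed.
Lemma form_param_sub x : L x -> R x.
Proof. by case: RL => _ [LR _ _ _]; apply: LR. Qed.
Lemma form_param0 : L 0.
Proof. by case: RL => _ [_ [+ _] _ _]; rewrite inE. Qed.
Lemma form_paramD x y : L x -> L y -> L (x + y).
Proof. by case: RL => _ [_ [_ LB] _ _] Lx Ly; have := LB x y; rewrite !inE opp2; apply. Qed.
Lemma form_paramM x y : R x -> L y -> L (x ^+ 2 * y).
Proof. by case: RL => _ [_ _ _]; apply. Qed.

End FormRing.

Section Elementary.
Variables (R L : set A) (P : M -> Prop).
Hypotheses (n_ge3 : (3 <= n)%N) (RL : is_form_ring R L).
Hypothesis P_mul : mul_stable P.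
Hypothesis P_short : forall xi a b, R xi -> indep a b -> P (X (e a) (xi *: e b)).
Hypothesis P_long : forall lam a, L lam -> P (T lam (e a)).

Let PM := P_mul.2.

Let LR := form_param_sub RL.
Let R0 := form_ring0 RL.
Let R1 := form_ring1 RL.
Let RD := form_ringD RL.
Let RM := form_ringM RL.
Let L0 := form_param0 RL.
Let LM := form_paramM RL.

(** Since Y (e a) is additive, multiples of basis vectors are enough. *)
Lemma elem_Y a r : (forall i, R r.@i) -> r.@(s a) = 0 -> P (Y (e a) r).
Proof.
move=> Rr ra; rewrite (vec_sum r); apply: Y_sum => // i _.
rewrite BZr Be crd_e; case: (eqVneq i (s a)) => [->|isa].
  by rewrite ra mul0r scale0r Y0; split=> //; apply: P_mul.1.
rewrite mulr0; split=> //.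
rewrite Y_isotropic ?qZ ?qe ?mulr0 //.
case: (eqVneq i a) => [->|ia]; first by rewrite Xvv; apply: P_mul.1.
by apply: P_short => //; apply/andP.
Qed.

Lemma elem_X a r : (forall i, R r.@i) -> r.@(s a) = 0 -> L (q r) -> P (X (e a) r).
Proof.
move=> Rr ra Lq; rewrite -[X _ _]mulmx1 -(TT (q r) (e a)) mulmxA.
by apply: PM; [apply: elem_Y | apply: P_long].
Qed.

(** A commutator through the pair of l, as in the commutator formula of SL_3:
    X (e_{-l}) v maps e_l to e_l + v and fixes u. *)
Lemma elem_X_spare l u v : (forall i, R u.@i) -> (forall i, R v.@i) ->
  u.@l = 0 -> u.@(s l) = 0 -> v.@l = 0 -> v.@(s l) = 0 ->
  q u = 0 -> q v = 0 -> B u v = 0 -> P (X u v).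
Proof.
move=> Ru Rv ul usl vl vsl qu qv uv.
pose y := X (e (s l)) v.
have yB : B (e (s l)) v = 0 by rewrite Be rev_ordK.
have Py : P y by apply: elem_X; rewrite ?rev_ordK ?qv.
have Pg : P (X (e l) u) by apply: elem_X; rewrite ?qu.
have yl : y *m e l = e l + v.
  by rewrite Xv Be rev_ordK crd_e eqxx BC Be vsl scale0r addr0 scale1r.
have yu : y *m u = u.
  by rewrite Xv Be rev_ordK ul [B v u]BC uv !scale0r !addr0.
have uel : B u (e l) = 0 by rewrite BC Be.
have -> : X u v = X (e l) u *m (y *m X (e l) u *m y).
  rewrite X_conj_X // -/y yl yu [X (e l + v) u]XC [X (e l) u]XC.
  have := X_add uel uv; rewrite Be vsl T0 mulmx1 => ->.
  by rewrite mulmxA XX // mul1mx.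
by apply: PM => //; do 2?apply: PM.
Qed.

(** X (e_{-a}) p maps e_a to e_a + p, hence conjugates T t e_a into
    T t (e_a + p), which differs from T t p by root elements along e_a. *)
Lemma elem_T_spare a p t : (forall i, R p.@i) -> p.@a = 0 -> p.@(s a) = 0 ->
  L t -> L (q p) -> P (T t p).
Proof.
move=> Rp pa psa Lt Lq.
pose y := X (e (s a)) p.
have yB : B (e (s a)) p = 0 by rewrite Be rev_ordK.
have Py : P y by apply: elem_X; rewrite ?rev_ordK.
have ya : y *m e a = e a + p.
  by rewrite Xv Be rev_ordK crd_e eqxx BC Be psa scale0r addr0 scale1r.
have eap : B (e a) p = 0 by rewrite Be.
have PX : P (X (e a) (t *: p)).
  apply: elem_X => [i||]; rewrite ?qZ ?crdZ ?psa ?mulr0 //; first by auto.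
  by apply: LM => //; apply: LR.
have := T_add t eap; rewrite -ya -(X_conj_T t _ yB) -/y => E.
have -> : T t p = T t (e a) *m (y *m T t (e a) *m y *m X (e a) (t *: p)).
  rewrite E !mulmxA TT mul1mx -mulmxA XX ?mulmx1 //.
  by rewrite BZr eap mulr0.
have PT : P (T t (e a)) by exact: P_long.
by do !apply: PM.
Qed.

Lemma elem_T_plane a b x y t : indep a b ->
  L (t * x ^+ 2) -> L (t * y ^+ 2) -> R (t * (x * y)) ->
  P (T t (x *: e a + y *: e b)).
Proof.
move=> ab Lx Ly Rxy; have bsa : b != s a by case/andP: ab.
rewrite T_add; last by rewrite BZl BZr Be crd_e eq_sym (negPf bsa) !mulr0.
rewrite !TZ XZ !scalerA (_ : x * t * y = t * (x * y)); last by ring2.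
by apply: PM; [apply: PM|]; auto.
Qed.

Section Column.
Variables (v : V) (om : I -> A).
Hypotheses (Rv : forall i j, R (v.@i * v.@j)) (Rom : forall i, R (om i)).
Hypothesis v_unimodular : \sum_i om i * v.@i ^+ 2 = 1.

(** The vector c v splits into multiples of basis vectors orthogonal to the
    Koszul vector u, which contribute transformations along basis vectors, and
    a component in the pairs of i and j.  The latter contributes an element of
    SL_2 type, a transvection along u = (y, x) against w = (x, y), where
    x = v_{-i} and y = v_{-j}.  The
    coordinates of u and w are those of v and may lie outside R, but inserting
    1 = sum_k om_k v_k^2 and giving one factor v_k to u and one to w brings
    both into R, where a spare pair finishes the proof. *)
Lemma elem_Y_koszul i j c : indep i j -> R c -> P (Y (koszul v i j) (c *: v)).
Proof.
move=> ij Rc; have /andP[ji jsi] := ij; set u := koszul v i j.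
have sij : s i != s j by rewrite (inj_eq rev_ord_inj) eq_sym.
pose w := v.@(s i) *: e (s i) + v.@(s j) *: e (s j).
have -> : c *: v = c *: w + \sum_(k | (k != s i) && (k != s j)) (c * v.@k) *: e k.
  rewrite {1}(vec_sum v) (bigD1 (s i)) // (bigD1 (s j)) 1?eq_sym //=.
  rewrite addrA scalerDr scaler_sumr; congr (_ + _).
  by apply: eq_bigr => k _; rewrite scalerA.
have uw : B u w = 0.
  rewrite B_koszul /w !crdD !crdZ !crd_e !eqxx (negPf sij) eq_sym (negPf sij).
  rewrite !mulr0 !mulr1 addr0 add0r; ring2.
have u_rest k : k != s i -> k != s j -> B u (e k) = 0.
  move=> ki kj; rewrite B_koszul !crd_e !(eq_sym (s _)) (negPf ki) (negPf kj).
  by rewrite !mulr0 addr0.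
rewrite YD ?BZr ?uw ?mulr0 //; last first.
  by rewrite (big_morph (B u) (BDr u) (B0r u)) big1 // => k /andP[? ?]; rewrite BZr u_rest // mulr0.
apply: PM; last first.
  apply: Y_sum => // k /andP[ki kj]; rewrite BZr u_rest // mulr0; split=> //.
  rewrite Y_isotropic ?qZ ?qe ?mulr0 //.
  rewrite -XZ XC -Y_isotropic ?qZ ?q_koszul ?mulr0 //.
  apply: elem_Y => [l|].
    rewrite crdZ -mulrA; apply: RM => //.
    rewrite crdD !crdZ !crd_e mulrDr !mulrA.
    by apply: RD; apply: RM => //; case: eqP.
  by rewrite -Be BZr BC u_rest // mulr0.
have -> : c *: w = \sum_k (c * (om k * v.@k ^+ 2)) *: w.
  by rewrite -scaler_suml -mulr_sumr v_unimodular mulr1.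
apply: Y_sum => // k _; rewrite BZr uw mulr0; split=> //.
have qw : q w = 0.
  rewrite qD !qZ !qe BZl BZr Be crd_e rev_ordK (eq_sym i) -(inj_eq rev_ord_inj) rev_ordK.
  by rewrite (negPf jsi) !mulr0 !addr0.
rewrite Y_isotropic ?qZ ?qw ?mulr0 // (_ : _ * _ = (c * om k * v.@k) * v.@k); last by ring2.
rewrite -scalerA -XZ.
have [l [/andP[li lsi] /andP[lj lsj]]] := third_index n_ge3 i j.
have sne (a b : I) : a != s b -> s a != b.
  by rewrite -(inj_eq rev_ord_inj) rev_ordK.
have u0 x : x != i -> x != j -> u.@x = 0.
  by move=> xi xj; rewrite crdD !crdZ !crd_e (negPf xi) (negPf xj) !mulr0 addr0.
have w0 x : x != s i -> x != s j -> w.@x = 0.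
  by move=> xi xj; rewrite crdD !crdZ !crd_e (negPf xi) (negPf xj) !mulr0 addr0.
apply: (@elem_X_spare l).
- move=> x; rewrite crdZ -mulrA; apply: RM; first exact: RM.
  by rewrite crdD !crdZ !crd_e mulrDr !mulrA; apply: RD; apply: RM => //; case: eqP.
- by move=> x; rewrite crdZ crdD !crdZ !crd_e mulrDr !mulrA; apply: RD; apply: RM => //; case: eqP.
- by rewrite crdZ u0 ?mulr0.
- by rewrite crdZ u0 ?mulr0 ?sne.
- by rewrite crdZ w0 ?mulr0.
- by rewrite crdZ w0 ?mulr0 ?(inj_eq rev_ord_inj).
- by rewrite qZ q_koszul ?mulr0.
- by rewrite qZ qw mulr0.
- by rewrite BZl BZr uw !mulr0.
Qed.

(** It suffices to treat the multiples p = v_{-a} v, which have coordinates in R.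
    The vector r below is orthogonal to v, isotropic, and cancels both
    coordinates of p in the pair of c.  So T p is the product of T (p + r),
    T r and X p r; the first two are covered by [elem_T_spare], and the last
    one by the previous lemma, since r is a combination of Koszul vectors. *)
Lemma elem_T_column t : (forall i l, L l -> L (l * v.@i ^+ 2)) ->
  (forall i l, L l -> L (l * om i)) -> L (q v) -> L t -> P (T t v).
Proof.
move=> Lv Lom Lq.
have RZ c i j : R c -> R (c * v.@i * v.@j) by move=> Rc; rewrite -mulrA; apply: RM.
(* Y v (c u) and Y u (c v) agree up to T (q (c v)) u, as q u = 0. *)
have siegel_koszul c i j : indep i j -> R c -> P (Y v (c *: koszul v i j)).
  move=> ij Rc; rewrite Y_isotropic ?qZ ?q_koszul ?mulr0 // XC XZ.
  rewrite -[X _ _]mulmx1 -(TT (q (c *: v)) (koszul v i j)) mulmxA.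
  apply: PM; first exact: elem_Y_koszul.
  have Rq : R (c ^+ 2 * q v) by rewrite expr2 -mulrA; do 2?apply: RM => //; apply: LR.
  have Lqc : L (c ^+ 2 * q v) by exact: LM.
  by rewrite qZ; apply: elem_T_plane => //; try apply: Lv => //; apply: RM.
suff T_multiple a l : L l -> P (T l (v.@(s a) *: v)).
  move=> Lt; rewrite -[t]mulr1 -v_unimodular mulr_sumr.
  apply: (big_ind (fun x => P (T x v))) => [|x y Px Py|i _].
  - by rewrite T0; apply: P_mul.1.
  - by rewrite TD; apply: PM.
  - by rewrite mulrA -TZ -[i]rev_ordK; apply: T_multiple; apply: Lom.
move=> Ll; set d := s a.
have [b [ab _]] := third_index n_ge3 a a; have /andP[ba bsa] := ab.
have [c [ac bc]] := third_index n_ge3 a b.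
have /andP[ca csa] := ac; have /andP[cb csb] := bc.
have sne (x y : I) : x != s y -> s x != y.
  by rewrite -(inj_eq rev_ord_inj) rev_ordK.
have sns (x y : I) : x != y -> s x != s y by rewrite (inj_eq rev_ord_inj).
(* The e_a-components make r orthogonal to v; the index b supplies a second
   copy of the cancelling part, which makes r isotropic. *)
pose r := v.@c *: koszul v a b + v.@(s c) *: koszul v a (s b)
  + v.@c *: koszul v a c + v.@(s c) *: koszul v a (s c).
pose r' := v.@d *: (v.@c *: e b + v.@(s c) *: e (s b) + v.@c *: e c + v.@(s c) *: e (s c)).
pose z := v.@c * v.@(s b) + v.@(s c) * v.@b.
have rE : r = r' + z *: e a.
  rewrite /r /r' /koszul /z !rev_ordK -/d; vec2.
have vr : B v r = 0.
  by rewrite !BDr !BZr ![B v _]BC !B_koszul_self !mulr0 !addr0.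
have r'0 x : x != b -> x != s b -> x != c -> x != s c -> r'.@x = 0.
  move=> xb xsb xc xsc; rewrite !(crdZ, crdD) !crd_e.
  by rewrite (negPf xb) (negPf xsb) (negPf xc) (negPf xsc) !mulr0 !addr0 mulr0.
have r'a : r'.@a = 0 by rewrite r'0 // 1?eq_sym // sne.
have r'sa : r'.@(s a) = 0 by rewrite r'0 // 1?eq_sym // sns // eq_sym.
have qr' : q r' = 0.
  rewrite qZ !qD !(qZ, qe) !(BDl, BZl, BZr) !Be !crd_e !rev_ordK.
  have bsc : b == s c = false by rewrite -(inj_eq rev_ord_inj) rev_ordK eq_sym (negPf csb).
  rewrite !eqxx (inj_eq rev_ord_inj) bsc ![_ == c]eq_sym (negPf cb) (negPf csb).
  rewrite !mulr0 !mulr1 !addr0 !add0r; ring2.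
have qr : q r = 0.
  by rewrite rE qD qr' qZ qe BZr BC Be r'sa !mulr0 !addr0.
have Rz : R z by apply: RD; auto.
have Rr' i : R r'.@i.
  rewrite crdZ !crdD !crdZ !crd_e !mulrDr !mulrA.
  by do 3?apply: RD; apply: RM => //; case: eqP.
have r_spare : P (T l r).
  rewrite rE T_add; last by rewrite BZr BC Be r'sa mulr0.
  apply: PM; first apply: PM.
  - by apply: (@elem_T_spare a); rewrite ?qr'.
  - by rewrite TZ mulrC; apply: P_long; apply: LM.
  - rewrite scalerA -XZ XC; apply: elem_X => [i||].
    + by rewrite crdZ; apply: RM => //; apply: RM => //; apply: LR.
    + by rewrite crdZ r'sa mulr0.
    + by rewrite qZ qr' mulr0.
set p := v.@d *: v.
have pr : B p r = 0 by rewrite BZl vr mulr0.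
have plr : B p (l *: r) = 0 by rewrite BZr pr mulr0.
have -> : T l p = T l (p + r) *m X p (l *: r) *m T l r.
  rewrite T_add // -[_ *m X _ _ *m X _ _]mulmxA XX // mulmx1 -mulmxA TT mulmx1 //.
apply: PM => //; apply: PM.
- have pc x : x != a -> (p + r').@x = 0 -> (p + r).@x = 0.
    by move=> xa; rewrite rE addrA => E; rewrite crdD E (crdZ z) crd_e (negPf xa) mulr0 addr0.
  apply: (@elem_T_spare c) => //.
  + move=> i; rewrite crdD; apply: RD; first by rewrite crdZ.
    by rewrite rE crdD; apply: RD => //; rewrite (crdZ z) crd_e; apply: RM => //; case: eqP.
  + apply: pc => //; rewrite crdD !(crdZ, crdD) !crd_e eqxx (negPf cb) (negPf csb).
    rewrite eq_sym s_neq !mulr0 mulr1 !add0r addr0; ring2.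
  + apply: pc; first exact: sne.
    rewrite crdD !(crdZ, crdD) !crd_e eqxx s_neq !(inj_eq rev_ord_inj) (negPf cb).
    rewrite -(inj_eq rev_ord_inj) rev_ordK (negPf csb) !mulr0 mulr1 !add0r; ring2.
  + by rewrite qD qr pr !addr0 qZ mulrC; apply: Lv.
- rewrite XZ -Y_isotropic ?qZ ?qr ?mulr0 //.
  have vk i j : B v (koszul v i j) = 0 by rewrite BC B_koszul_self.
  have Rl : R l by exact: LR.
  rewrite scalerA /r 3!scalerDr !scalerA.
  rewrite 3?YD ?BDr ?BZr ?vk ?mulr0 ?addr0 //.
  have Rc i : R (v.@d * l * v.@i) by rewrite [_ * l]mulrC; auto.
  apply: PM; [apply: PM; [apply: PM|]|]; apply: siegel_koszul => //;
    by rewrite indepsr.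
Qed.

End Column.

End Elementary.

(** * Commutators *)

Lemma X_sub u v w : B u v = 0 -> B u w = 0 -> B v w = 0 ->
  X u v *m X u (v + w) = X u w.
Proof.
move=> uv uw vw; have := X_add uv uw; rewrite vw T0 mulmx1 => ->.
by rewrite mulmxA XX // mul1mx.
Qed.

(** With 2 = 0 the product of T 1 v and T 1 (v + u) is X v u T 1 u.  Multiplying
    by its translate under v |-> v + d removes v altogether. *)
Lemma double_commutator u v d : B u v = 0 -> B u d = 0 -> B v d = 0 ->
  (T 1 v *m T 1 (v + u)) *m (T 1 (v + d) *m T 1 (v + d + u)) = X u d.
Proof.
move=> uv ud vd; apply: mxvP => w.
rewrite -!mulmxA !(Tv, Xv) !(BDr, BDl, BZr, BZl) !Bvv [B v u]BC [B d u]BC [B d v]BC uv ud vd.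
vec2.
Qed.

Lemma X_T_comm u v t : B u v = 0 -> X u v *m T t u = T t u *m X u v.
Proof.
move=> uv; rewrite (isometry_T _ _ (X_isometry uv)) Xv [B v u]BC uv Bvv.
by rewrite !scale0r !addr0.
Qed.

Lemma X_conj_mul u v g h : B u v = 0 ->
  X u v *m (g *m h) *m X u v = (X u v *m g *m X u v) *m (X u v *m h *m X u v).
Proof. by move=> uv; rewrite !mulmxA -[_ *m X u v *m X u v]mulmxA XX // mulmx1. Qed.

Lemma Bei a b : indep a b -> B (e a) (e b) = 0.
Proof. by case/andP=> _ ba; rewrite Be crd_e eq_sym (negPf ba). Qed.
Lemma Beslr a : B (e (s a)) (e a) = 1.
Proof. by rewrite Be crd_e rev_ordK eqxx. Qed.
Lemma Bers a : B (e a) (e (s a)) = 1.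
Proof. by rewrite BC Beslr. Qed.

Lemma Xei a b c x y : indep a c -> indep b c -> X (x *: e a) (y *: e b) *m e c = e c.
Proof. by move=> ac bc; rewrite Xv !BZl !Bei // !mulr0 !scale0r !addr0. Qed.

Lemma Xes a b x : indep a b -> X (e (s a)) (x *: e b) *m e a = e a + x *: e b.
Proof.
move=> ab; rewrite Xv BZl (@Bei b) 1?indepC // Beslr mulr0.
by rewrite scale0r addr0 scale1r.
Qed.

(** The part of a commutator of T t v that is not elementary is a transvection
    along u; its parameter t + t^2 q(v) is the one by which T t v changes q. *)
Lemma Y_commutator u v t : B u v = 0 ->
  Y u (t *: v) *m (T t v *m T t (v + u)) = T (t + t ^+ 2 * q v) u.
Proof.
move=> uv; have utv : B u (t *: v) = 0 by rewrite BZr uv mulr0.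
apply: mxvP => w; rewrite -[LHS]mulmxA (Yv _ utv) -mulmxA !Tv.
rewrite !(BDr, BDl, BZr, BZl, qZ) !Bvv [B v u]BC uv.
vec2.
Qed.

Lemma X_as_T u v : B u v = 0 -> X u v = T 1 u *m T 1 v *m T 1 (u + v).
Proof.
move=> uv; apply: mxvP => w; rewrite -!mulmxA !Tv Xv !(BDr, BZr) !Bvv [B v u]BC uv.
vec2.
Qed.

Ltac ind := rewrite ?(indepsl, indepsr) //; rewrite indepC ?(indepsl, indepsr) //.

Lemma X_commutator a b c x y : indep a b -> indep a c -> indep b c ->
  X (e a) (x *: e b) *m (X (e (s b)) (y *: e c) *m X (e a) (x *: e b) *m X (e (s b)) (y *: e c))
  = X (e a) ((x * y) *: e c).
Proof.
move=> ab ac bc.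
have bcB : B (e (s b)) (y *: e c) = 0 by rewrite BZr Bei ?mulr0 ?indepsl.
rewrite X_conj_X // -scalemxAr Xes // -[e (s b)]scale1r Xei; try ind.
by rewrite scalerDr scalerA X_sub // ?(BZr, BZl) Bei ?mulr0.
Qed.

Lemma T_commutator a b lam x : indep a b ->
  T lam (e b) *m (X (e (s b)) (x *: e a) *m T lam (e b) *m X (e (s b)) (x *: e a))
  = T (lam * x ^+ 2) (e a) *m X (e a) ((lam * x) *: e b).
Proof.
move=> ab.
have abB : B (e (s b)) (x *: e a) = 0 by rewrite BZr Bei ?mulr0 //; ind.
have baB : B (e b) (x *: e a) = 0 by rewrite BZr Bei ?mulr0 //; ind.
rewrite X_conj_T // Xes; last by ind.
rewrite T_add // !mulmxA TT mul1mx TZ scalerA.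
by rewrite -XZ XC.
Qed.

(** * The form ring of a subgroup *)

Section Coefficients.
Variable H : M -> Prop.
Hypotheses (n_ge3 : (3 <= n)%N) (H_mul : mul_stable H).
Hypothesis H_short1 : forall a b, indep a b -> H (X (e a) (e b)).
Hypothesis H_long1 : forall a, H (T 1 (e a)).

Let HM := H_mul.2.

Definition short_coeffs : set A :=
  [set xi | forall a b, indep a b -> H (X (e a) (xi *: e b))].
Definition long_coeffs : set A := [set lam | forall a, H (T lam (e a))].

Local Notation R := short_coeffs.
Local Notation L := long_coeffs.

Lemma conj_mem g y : H g -> H y -> H (y *m g *m y).
Proof. by move=> Hg Hy; do 2?apply: HM. Qed.

Lemma X_move a b c x y : indep a b -> indep a c -> indep b c ->
  H (X (e a) (x *: e b)) -> H (X (e (s b)) (y *: e c)) -> H (X (e a) ((x * y) *: e c)).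
Proof.
move=> ab ac bc Hab Hbc; rewrite -(X_commutator x y ab ac bc).
by apply: HM => //; apply: conj_mem.
Qed.

Lemma e1 a : 1 *: e a = e a. Proof. exact: scale1r. Qed.

Lemma X_move1 a b c x : indep a b -> indep a c -> indep b c ->
  H (X (e a) (x *: e b)) -> H (X (e a) (x *: e c)).
Proof.
move=> ab ac bc Hab; rewrite -[x]mulr1; apply: X_move Hab _ => //.
by rewrite e1; apply: H_short1; rewrite indepsl.
Qed.

(** The Weyl group permutes the short roots transitively; commutators with
    elements over F_2 play its role. *)
Lemma short_coeff_one a b x : indep a b -> H (X (e a) (x *: e b)) -> R x.
Proof.
have swap i j : H (X (e i) (x *: e j)) -> H (X (e j) (x *: e i)) by rewrite -XZ XC.
have move_r i j k : indep i j -> indep i k -> H (X (e i) (x *: e j)) -> H (X (e i) (x *: e k)).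
  move=> ij ik Hij; have [l [il jl]] := third_index n_ge3 i j.
  have [jk|] := boolP (indep j k); first exact: X_move1 Hij.
  rewrite negb_and !negbK => /orP[/eqP->//|/eqP kj].
  have lk : indep l k by rewrite kj; ind.
  by apply: (X_move1 il ik lk); apply: X_move1 Hij.
move=> ab Hab c d cd; have [ad|] := boolP (indep a d).
  apply: (swap _ _); apply: (move_r _ a); [ind | ind |].
  by apply: (swap _ _); apply: (move_r _ _ _ _ _ Hab).
move=> nad; have da : (d == a) || (d == s a) by rewrite -[X in is_true X]negbK negb_or.
have ac : indep a c.
  by case/orP: da cd => /eqP->; rewrite ?indepsr indepC.
apply: (move_r _ a); [ind | exact: cd |].
by apply: (swap _ _); apply: (move_r _ _ _ _ _ Hab).
Qed.

Let R1 : R 1.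
Proof. by move=> a b ab; rewrite e1; apply: H_short1. Qed.

Let RD x y : R x -> R y -> R (x + y).
Proof.
move=> Rx Ry a b ab; have := HM (Rx a b ab) (Ry a b ab).
rewrite -X_add ?BZr ?BZl ?Bvv ?Bei ?mulr0 // T0 mulmx1.
by rewrite -scalerDl.
Qed.

Let RM x y : R x -> R y -> R (x * y).
Proof.
move=> Rx Ry a c ac; have [b [ab cb]] := third_index n_ge3 a c.
apply: (@X_move a b) => //; [ind | exact: Rx |].
by apply: Ry; ind.
Qed.

Let R0 : R 0.
Proof. by rewrite -(add2x 1); apply: RD; apply: R1. Qed.

Let L1 : L 1. Proof. exact: H_long1. Qed.

Let LD x y : L x -> L y -> L (x + y).
Proof. by move=> Lx Ly a; rewrite TD; apply: HM. Qed.

Let L0 : L 0.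
Proof. by rewrite -(add2x 1); apply: LD; apply: L1. Qed.

Lemma T_move a b lam x : indep a b -> H (T lam (e b)) -> H (X (e (s b)) (x *: e a)) ->
  H (T (lam * x ^+ 2) (e a) *m X (e a) ((lam * x) *: e b)).
Proof.
move=> ab Hb Hab; rewrite -(T_commutator lam x ab).
by apply: HM => //; apply: conj_mem.
Qed.

(** An element over F_2 that fixes e_a and moves e_b to e_b + e_c changes the
    second factor only, so the quotient of both products is X (e a) (m e_c). *)
Lemma T_X_split a b m : indep a b ->
  H (T m (e a) *m X (e a) (m *: e b)) -> R m /\ H (T m (e a)).
Proof.
move=> ab Hab; have [c [ac bc]] := third_index n_ge3 a b.
have Hy : H (X (e (s b)) (1 *: e c)) by rewrite e1; apply: H_short1; ind.
have yB : B (e (s b)) (1 *: e c) = 0 by rewrite BZr Bei ?mulr0 //; ind.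
have ya : X (e (s b)) (1 *: e c) *m e a = e a by rewrite -[e (s b)]e1 Xei //; ind.
have Rm : R m.
  apply: (@short_coeff_one a c) => //.
  have := HM Hab (conj_mem Hab Hy); rewrite X_conj_mul //.
  rewrite X_conj_T // X_conj_X // ya -scalemxAr Xes // scale1r scalerDr.
  rewrite -mulmxA (mulmxA (X _ _)) X_T_comm ?BZr ?Bei ?mulr0 // -mulmxA X_sub //.
    by rewrite mulmxA TT mul1mx.
  1-3: by rewrite ?BZr ?BZl Bei ?mulr0.
split=> //; rewrite -[T _ _]mulmx1 -(@XX (e a) (m *: e b)); last by rewrite BZr Bei ?mulr0.
by rewrite mulmxA; apply: HM => //; apply: Rm.
Qed.

Lemma long_coeff_one b t : H (T t (e b)) -> L t /\ R t.
Proof.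
move=> Hb.
have spread a : indep a b -> R t /\ H (T t (e a)).
  move=> ab; apply: (@T_X_split a b) => //.
  have := @T_move a b t 1 ab Hb; rewrite expr1n !mulr1; apply.
  by rewrite e1; apply: H_short1; ind.
have [c [bc _]] := third_index n_ge3 b b.
have Rt : R t by have [] // := spread c; rewrite indepC.
split=> // a; have [ab|nab] := boolP (indep a b); first by case: (spread a ab).
have [d [ad bd]] := third_index n_ge3 a b.
have Hd : H (T t (e d)) by case: (spread d); first by rewrite indepC.
have := @T_move a d t 1 ad Hd; rewrite expr1n !mulr1 e1 => Had.
have [] // := @T_X_split a d t ad; apply: Had; apply: H_short1; ind.
Qed.

Let LR t : L t -> R t.
Proof. by move=> Lt; case: (long_coeff_one (Lt (pidx (Ordinal (ltnW (ltnW n_ge3)))))). Qed.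

Let LM x t : R x -> L t -> L (x ^+ 2 * t).
Proof.
move=> Rx Lt a; have [b [ab _]] := third_index n_ge3 a a.
have Rtx : R (t * x) by apply: RM => //; apply: LR.
have : H (T (t * x ^+ 2) (e a) *m X (e a) ((t * x) *: e b)).
  by apply: T_move => //; apply: Rx; ind.
move/HM/(_ (Rtx a b ab)); rewrite -mulmxA XX ?mulmx1 1?mulrC //.
by rewrite BZr Bei ?mulr0.
Qed.

Lemma coeffs_form_ring : is_form_ring R L.
Proof.
split; split.
- by rewrite inE; apply: R1.
- by move=> x y; rewrite !inE opp2; apply: RD.
- by move=> x y; rewrite !inE; apply: RM.
- by move=> t; apply: LR.
- by split; [rewrite inE; apply: L0 | move=> x y; rewrite !inE opp2; apply: LD].
- by move=> x _; rewrite A2 mul0r; apply: L0.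
- by move=> x t; apply: LM.
Qed.

(** Moving e_i to e_i + e_l changes the transvection by T and X factors along
    e_l; their part along e_j is known to lie in H, and the remaining part is
    of the form treated by [T_X_split]. *)
Lemma plane_long_coeff i j x y t : indep i j -> R (t * (x * y)) ->
  H (T t (x *: e i + y *: e j)) -> L (t * x ^+ 2).
Proof.
move=> ij Rxy Hu; have [l [il jl]] := third_index n_ge3 i j.
have Hg : H (X (e (s i)) (1 *: e l)) by rewrite e1; apply: H_short1; ind.
have gB : B (e (s i)) (1 *: e l) = 0 by rewrite BZr Bei ?mulr0 //; ind.
have [] // := @long_coeff_one l (t * x ^+ 2).
have li : indep l i by rewrite indepC.
have lj : indep l j by rewrite indepC.
have [] // := @T_X_split l i (t * x ^+ 2) li.
have := HM (HM Hu (conj_mem Hu Hg)) (Rxy l j lj).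
rewrite X_conj_T // (mulmxDr (X (e (s i)) (1 *: e l))) -!scalemxAr Xes // e1.
have -> : X (e (s i)) (e l) *m e j = e j.
  by rewrite -[e (s i)]e1 -[e l]e1 Xei //; ind.
set u := x *: e i + y *: e j.
have ul : B u (x *: e l) = 0 by rewrite BDl !BZl !BZr !Bei // !mulr0 addr0.
have -> : T t (x *: (e i + e l) + y *: e j)
    = T t u *m T t (x *: e l) *m X u (t *: (x *: e l)).
  by rewrite -T_add // /u scalerDr addrAC.
rewrite !mulmxA TT mul1mx TZ -!mulmxA.
suff -> : X u (t *: (x *: e l)) *m X (e l) ((t * (x * y)) *: e j)
  = X (e l) ((t * x ^+ 2) *: e i) by [].
apply: mxvP => w; rewrite -mulmxA !Xv !(BDr, BDl, BZr, BZl) !Bvv ![B (e l) _]BC !Bei //.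
vec2.
Qed.

(** Two steps of taking v to v + u and to v + d, by the root elements of
    e_b, e_{-a} and of e_c, e_{-a}, leave an element of the unipotent radical
    that belongs to the isotropic span of e_b, e_c and e_{-a}. *)
Lemma vector_short v a b c : indep a b -> indep a c -> indep b c -> H (T 1 v) ->
  H (X (v.@a *: e b + v.@(s b) *: e (s a)) (v.@a *: e c + v.@(s c) *: e (s a))).
Proof.
move=> ab ac bc Hv; set u := _ + _; set d := (X in H (short_transformation _ X)).
have ds : B (e b) (e (s a)) = 0 by rewrite Bei //; ind.
have cs : B (e c) (e (s a)) = 0 by rewrite Bei //; ind.
have ca : B (e (s a)) (e c) = 0 by rewrite BC.
have ba : B (e (s a)) (e b) = 0 by rewrite BC.
have cb : B (e c) (e b) = 0 by rewrite Bei // indepC.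
have Hy : H (X (e b) (e (s a))) by apply: H_short1; ind.
have Hg : H (X (e c) (e (s a))) by apply: H_short1; ind.
have yv : X (e b) (e (s a)) *m v = v + u by rewrite Xv !Be rev_ordK addrA.
have gv : X (e c) (e (s a)) *m v = v + d by rewrite Xv !Be rev_ordK addrA.
have vu : B v u = 0 by rewrite BDr !BZr ![B v _]BC !Be rev_ordK; ring2.
have vd : B v d = 0 by rewrite BDr !BZr ![B v _]BC !Be rev_ordK; ring2.
have ud : B u d = 0.
  by rewrite !(BDr, BDl, BZr, BZl) Bvv ds ca (@Bei b c) // !(mulr0, addr0).
have gu : X (e c) (e (s a)) *m u = u.
  by rewrite Xv !(BDr, BDl, BZr, BZl) Bvv cs cb ba !(mulr0, addr0, scale0r).
rewrite -(double_commutator (v := v)) // 1?BC //.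
have HZ : H (T 1 v *m T 1 (v + u)).
  by apply: HM => //; rewrite -yv -X_conj_T //; apply: conj_mem.
apply: HM => //; have := conj_mem HZ Hg.
by rewrite X_conj_mul // !X_conj_T // (mulmxDr (X (e c) (e (s a)))) gu gv.
Qed.

(** Replacing e_c by e_c + e_{-b} adds v_a e_{-b} to the second vector of
    [vector_short], and X u (v_a e_{-b}) is a single root element because
    X e_{-b} e_{-b} is trivial. *)
Lemma vector_products v a b : indep a b -> H (T 1 v) -> R (v.@a * v.@b).
Proof.
move=> ab Hv; have [c [ac bc]] := third_index n_ge3 a b.
have asb : indep a (s b) by rewrite indepsr.
have sbc : indep (s b) c by rewrite indepsl.
have HX := vector_short asb ac sbc Hv; rewrite rev_ordK in HX.
set u := _ + _ in HX; set d := (X in H (short_transformation _ X)) in HX.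
have cb : B (e c) (e (s b)) = 0 by rewrite Bei // indepC.
have ba : B (e (s a)) (e (s b)) = 0 by rewrite Bei //; ind.
have ud : B u d = 0.
  rewrite !(BDr, BDl, BZr, BZl) Bvv (@Bei (s b) c) // (@Bei (s b) (s a)); last by ind.
  by rewrite (@Bei (s a) c) ?indepsl // !(mulr0, addr0).
pose g := X (e (s c)) (1 *: e (s b)).
have Hg : H g by rewrite /g e1; apply: H_short1; ind.
have gB : B (e (s c)) (1 *: e (s b)) = 0 by rewrite BZr Bei ?mulr0 //; ind.
have gfix x : indep c x -> indep b x -> g *m e x = e x.
  by move=> cx bx; rewrite /g -[e (s c)]e1 Xei ?indepsl.
have gb : g *m e (s b) = e (s b).
  rewrite /g e1 Xv Bvv Be rev_ordK crd_e.
  by case/andP: sbc => /negPf-> _; rewrite !scale0r !addr0.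
have gu : g *m u = u.
  by rewrite (mulmxDr g) -!scalemxAr gb gfix //; ind.
have gd : g *m d = d + v.@a *: e (s b).
  rewrite (mulmxDr g) -!scalemxAr /g Xes; last by ind.
  by rewrite -/g gfix ?e1 ?scalerDr 1?addrAC //; ind.
have ub : B u (v.@a *: e (s b)) = 0.
  by rewrite !(BDl, BZl, BZr) Bvv ba !(mulr0, addr0).
have db : B d (v.@a *: e (s b)) = 0.
  by rewrite !(BDl, BZl, BZr) cb ba !(mulr0, addr0).
apply: (@short_coeff_one (s a) (s b)); first by rewrite indepsl.
have := HM HX (conj_mem HX Hg); rewrite X_conj_X // gu gd X_sub //.
congr H; apply: mxvP => w; rewrite !Xv !(BDl, BZl); vec2.
Qed.

(** The unipotent element of [vector_short] is the product of three root
    elements, two of which have parameters known from [vector_products]. *)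
Lemma vector_squares v a : H (T 1 v) -> R (v.@a ^+ 2).
Proof.
move=> Hv; have [b [ab _]] := third_index n_ge3 a a.
have [c [ac bc]] := third_index n_ge3 a b.
have ds : B (e b) (e (s a)) = 0 by rewrite Bei //; ind.
have cs : B (e c) (e (s a)) = 0 by rewrite Bei //; ind.
have ca : B (e (s a)) (e c) = 0 by rewrite BC.
have ba : B (e (s a)) (e b) = 0 by rewrite BC.
have Rac : R (v.@a * v.@(s c)) by apply: vector_products; rewrite ?indepsr.
have Rab : R (v.@a * v.@(s b)) by apply: vector_products; rewrite ?indepsr.
have HX := vector_short ab ac bc Hv.
apply: (@short_coeff_one b c) => //.
set u := _ + _ in HX; set d := (X in H (short_transformation _ X)) in HX.
have -> : X (e b) (v.@a ^+ 2 *: e c) = X u d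
    *m X (e b) ((v.@a * v.@(s c)) *: e (s a)) *m X (e (s a)) ((v.@a * v.@(s b)) *: e c).
  apply: mxvP => w; rewrite -!mulmxA !Xv !(BDr, BDl, BZr, BZl) !Bvv !ds !cs !ca !ba.
  rewrite [B (e c) (e b)]BC (@Bei b c) //; vec2.
by apply: HM; [apply: HM|] => //; [apply: Rac | apply: Rab]; ind.
Qed.

(** * Columns of matrices in the subgroup *)

Hypothesis H_isometry : forall h, H h -> isometry h.
Hypothesis H_inv : forall h, H h -> exists2 h', H h' & h *m h' = 1%:M.

Lemma T_column h v t : H h -> H (T t v) -> H (T t (h *m v)).
Proof.
move=> Hh Hv; have [h' Hh' hh'] := H_inv Hh.
rewrite -[T _ _]mulmx1 -hh' mulmxA -(isometry_T _ _ (H_isometry Hh)).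
by apply: HM => //; apply: HM.
Qed.

Lemma sqr_sum J (r : seq J) (F : J -> A) :
  (\sum_(j <- r) F j) ^+ 2 = \sum_(j <- r) F j ^+ 2.
Proof.
by apply: (big_morph (fun x => x ^+ 2)) => [x y|]; [ring2 | rewrite expr0n].
Qed.

Lemma R_sum J (r : seq J) (F : J -> A) : (forall j, R (F j)) -> R (\sum_(j <- r) F j).
Proof. by move=> RF; apply: (big_ind R). Qed.

Lemma L_sum J (r : seq J) (F : J -> A) : (forall j, L (F j)) -> L (\sum_(j <- r) F j).
Proof. by move=> LF; apply: (big_ind L). Qed.

Section Column.
Variable h : M.
Hypothesis Hh : H h.

Local Notation col k := (h *m e k).

Lemma column_T1 k : H (T 1 (col k)). Proof. by apply: T_column. Qed.

(** The square of the relation B(h e_k, h e_{-k}) = 1: squaring is additive. *)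
Lemma column_dual k : \sum_i (col (s k)).@(s i) ^+ 2 * (col k).@i ^+ 2 = 1.
Proof.
have := H_isometry Hh (e k) (e (s k)); rewrite Bers => /(congr1 (fun x => x ^+ 2)).
rewrite expr1n sqr_sum => <-; apply: eq_bigr => i _; ring2.
Qed.

(** Only v_i v_{-i} is not covered by the previous lemmas.  Applied to the vector
    X (e a) (e b) v they give v_a v_{-a} + v_b v_{-b}.  To separate the summands,
    multiply v_i v_{-i} by the relation of [column_dual]: each of the resulting
    terms v_l^2 v_i v_{-i} is a combination of known products. *)
Lemma column_products k i j : R ((col k).@i * (col k).@j).
Proof.
have Hv := column_T1 k; set v := col k in Hv *.
have [->|ji] := eqVneq j i; first by rewrite -expr2; apply: vector_squares.
have [->{j ji}|jsi] := eqVneq j (s i); last by apply: vector_products => //; apply/andP.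
have Rpair a b : indep a b -> R (v.@a * v.@(s a) + v.@b * v.@(s b)).
  move=> ab; have Hy : H (X (e a) (e b)) by apply: H_short1.
  have := vector_products ab (T_column Hy Hv).
  have -> : (X (e a) (e b) *m v).@a = v.@a + v.@(s b).
    rewrite Xv !Be !(crdD, crdZ) !crd_e eqxx.
    by case/andP: ab => ba _; rewrite eq_sym (negPf ba) mulr0 mulr1 addr0.
  have -> : (X (e a) (e b) *m v).@b = v.@b + v.@(s a).
    rewrite Xv !Be !(crdD, crdZ) !crd_e eqxx.
    by case/andP: ab => /negPf-> _; rewrite mulr0 mulr1 addr0.
  have Rab : R (v.@a * v.@b) by apply: vector_products.
  have Rs : R (v.@(s b) * v.@(s a)) by apply: vector_products => //; ind.
  move=> Rabs; have := RD Rabs (RD Rab Rs); congr R; ring2.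
rewrite -[_ * _]mul1r -(column_dual k) mulr_suml; apply: R_sum => l.
have Hw := column_T1 (s k); rewrite -mulrA; apply: RM; first exact: vector_squares.
rewrite -/v; have Rvv a b : indep a b -> R (v.@a * v.@b) by move=> ?; apply: vector_products.
have [b [ib _]] := third_index n_ge3 i i.
have Rib : R ((v.@i * v.@b) * (v.@i * v.@(s b))) by apply: RM; apply: Rvv; rewrite ?indepsr.
have [->|li] := eqVneq l i.
  have := RD (RM (vector_squares i Hv) (Rpair _ _ ib)) Rib; congr R; ring2.
have Rsib : R ((v.@(s i) * v.@b) * (v.@(s i) * v.@(s b))).
  by apply: RM; apply: Rvv; rewrite ?indepsr ?indepsl.
have [->|lsi] := eqVneq l (s i).
  have := RD (RM (vector_squares (s i) Hv) (Rpair _ _ ib)) Rsib; congr R; ring2.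
have il : indep i l by apply/andP.
have -> : v.@l ^+ 2 * (v.@i * v.@(s i)) = (v.@i * v.@l) * (v.@(s i) * v.@l) by ring2.
by apply: RM; apply: Rvv; rewrite ?indepsl.
Qed.

End Column.

Lemma mul_add_col a b : indep a b -> exists2 y, H y & y *m e a = e a + e b.
Proof.
move=> ab; exists (X (e (s a)) (e b)); first by apply: H_short1; ind.
by rewrite -[e b]scale1r Xes // e1.
Qed.

Section TwoColumns.
Variables (h : M) (a b : I).
Hypotheses (Hh : H h) (ab : indep a b).
Let v := h *m e a.
Let v' := h *m e b.
Let w := h *m e (s a).
Let w' := h *m e (s b).

(* The 2 x 2 minors of the columns v, v'; with 2 = 0 the sign is plus. *)
Let minor i j := v.@i * v'.@j + v.@j * v'.@i.

(** The Cauchy-Binet relation between the minors of (v, v') and those of the dual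
    columns (w, w'), squared. *)
Lemma minor_dual : \sum_i \sum_j (w.@(s i) * w'.@(s j)) ^+ 2 * minor i j ^+ 2 = 1.
Proof.
have vw : B v w = 1 by rewrite H_isometry // Bers.
have vw' : B v' w' = 1 by rewrite H_isometry // Bers.
have vw0 : B v' w = 0 by rewrite H_isometry // Bei //; ind.
transitivity ((B v w * B v' w' + B v' w * B v w') ^+ 2); last first.
  by rewrite vw vw' vw0 mul0r addr0 mulr1 expr1n.
rewrite /B !mulr_suml -big_split sqr_sum; apply: eq_bigr => i _ /=.
rewrite !mulr_sumr -big_split sqr_sum; apply: eq_bigr => j _ /=.
rewrite /minor; ring2.
Qed.

Lemma minor_short i j : R (minor i j).
Proof.
have [y Hy yE] := mul_add_col ab.
have := column_products (HM Hh Hy) a i j; rewrite -mulmxA yE (mulmxDr h) !crdD -/v -/v' => Rvv.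
have := RD Rvv (RD (column_products Hh a i j) (column_products Hh b i j)); congr R.
rewrite -/v -/v' /minor; ring2.
Qed.

(** The products v_k v_l of a single column and the minors are known, and
    v_i v'_j times a minor is a combination of products of the former; the
    minors generate the unit ideal by [minor_dual]. *)
Lemma cross_products i j : R (v.@i * v'.@j).
Proof.
rewrite -[_ * _]mul1r -minor_dual mulr_suml; apply: R_sum => k.
rewrite mulr_suml; apply: R_sum => l.
have -> : (w.@(s k) * w'.@(s l)) ^+ 2 * minor k l ^+ 2 * (v.@i * v'.@j)
  = w.@(s k) ^+ 2 * (w'.@(s l) ^+ 2 * (minor k l * (minor k l * (v.@i * v'.@j)))) by ring2.
apply: RM; first exact: vector_squares (column_T1 Hh _).
apply: RM; first exact: vector_squares (column_T1 Hh _).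
apply: RM; first exact: minor_short.
have := RD (RM (column_products Hh a k i) (column_products Hh b l j))
  (RM (column_products Hh a l i) (column_products Hh b k j)).
congr R; rewrite -/v -/v' /minor; ring2.
Qed.

End TwoColumns.

Let H_short xi a b : R xi -> indep a b -> H (X (e a) (xi *: e b)).
Proof. by move=> Rxi; apply: Rxi. Qed.
Let H_long lam a : L lam -> H (T lam (e a)).
Proof. by move=> Llam; apply: Llam. Qed.

(** The commutator of T t v with a root element over F_2 is the product of the
    element of [elem_Y_koszul] and a transvection along a Koszul vector, from
    which [plane_long_coeff] reads off the coefficient. *)
Lemma column_long h k i t : H h -> L t ->
  L ((t + t ^+ 2 * q (h *m e k)) * (h *m e k).@i ^+ 2).
Proof.
move=> Hh Lt; set v := h *m e k.
have [j [ij _]] := third_index n_ge3 i i.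
have jsi : indep j (s i) by ind.
have Rt := LR Lt.
have Hv : H (T t v) by apply: T_column.
have Hy : H (X (e j) (e (s i))) by apply: H_short1.
have Rq : R (q v) by apply: R_sum => l; apply: column_products.
have Rw l : R ((h *m e (s k)).@(s l) ^+ 2) by rewrite expr2; apply: column_products.
have HY : H (Y (koszul v j (s i)) (t *: v)).
  exact: (elem_Y_koszul n_ge3 coeffs_form_ring H_mul H_short H_long
    (column_products Hh k) Rw (column_dual Hh k)).
have HT : H (T (t + t ^+ 2 * q v) (koszul v j (s i))).
  rewrite -Y_commutator ?B_koszul_self //; apply: HM => //; apply: HM => //.
  have -> : v + koszul v j (s i) = X (e j) (e (s i)) *m v.
    by rewrite Xv !Be /koszul addrA.
  by rewrite -X_conj_T ?Bei //; apply: conj_mem.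
rewrite /koszul rev_ordK in HT; apply: (plane_long_coeff jsi _ HT).
apply: RM; last exact: column_products.
by apply: RD => //; apply: RM => //; rewrite expr2; apply: RM.
Qed.

Section ColumnPair.
Variables (h : M) (a b : I).
Hypotheses (Hh : H h) (ab : indep a b).
Let v := h *m e a.
Let v' := h *m e b.

(** [column_long] with t = 1 for v, v' and v + v': q is additive on orthogonal
    vectors, whereas the terms v_i^2 cancel. *)
Lemma pair_long i : L (q v' * v.@i ^+ 2 + q v * v'.@i ^+ 2).
Proof.
have Lv := column_long a i Hh L1; have Lv' := column_long b i Hh L1.
have [y Hy yE] := mul_add_col ab.
have := column_long a i (HM Hh Hy) L1; rewrite -mulmxA yE (mulmxDr h) crdD qD.
rewrite (H_isometry Hh) Bei // -/v -/v' in Lv Lv' *.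
move=> Lvv; have := LD Lvv (LD Lv Lv'); congr L; ring2.
Qed.

(** Eliminating q(v') between the relations for i and j leaves q(v) times a
    squared minor, and the minors are unimodular. *)
Lemma pair_qform_squares k : L (q v * v.@k ^+ 2).
Proof.
rewrite -[_ * _]mul1r -(minor_dual Hh ab) mulr_suml; apply: L_sum => i.
rewrite mulr_suml; apply: L_sum => j; rewrite -mulrA; apply: LM.
  by apply: cross_products => //; ind.
have := LD (LM (column_products Hh a j k) (pair_long i))
  (LM (column_products Hh a i k) (pair_long j)).
congr L; rewrite -/v -/v'; ring2.
Qed.

End ColumnPair.

Section Column.
Variables (h : M) (k : I).
Hypothesis Hh : H h.
Local Notation v := (h *m e k).

Lemma column_qform_squares i : L (q v * v.@i ^+ 2).
Proof. by have [c [kc _]] := third_index n_ge3 k k; apply: (pair_qform_squares Hh kc). Qed.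

Lemma column_squares t i : L t -> L (t * v.@i ^+ 2).
Proof.
move=> Lt; have := LD (column_long k i Hh Lt) (LM (LR Lt) (column_qform_squares i)).
congr L; ring2.
Qed.

End Column.

Lemma column_qform h k : H h -> L (q (h *m e k)).
Proof.
move=> Hh; rewrite -[q _]mul1r -(column_dual Hh k) mulr_suml; apply: L_sum => i.
rewrite -mulrA mulrC; apply: column_squares => //.
by rewrite mulrC; apply: column_qform_squares.
Qed.

(** * Conjugates of root elements are elementary *)

Lemma long_conj_elem P h k t : mul_stable P ->
  (forall xi a b, R xi -> indep a b -> P (X (e a) (xi *: e b))) ->
  (forall lam a, L lam -> P (T lam (e a))) ->
  H h -> L t -> P (T t (h *m e k)).
Proof.
move=> P_mul P_short P_long Hh Lt.
apply: (elem_T_column n_ge3 coeffs_form_ring P_mul P_short P_long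
  (column_products Hh k) _ (column_dual Hh k)) => //.
- by move=> l; rewrite expr2; apply: column_products.
- by move=> i l Ll; apply: column_squares.
- by move=> i l Ll; apply: column_squares.
- exact: column_qform.
Qed.

(** By [X_as_T] the element is a product of transvections along h e_b,
    xi (h e_a) and h e_b + xi (h e_a); the last vector is the column e_b of h
    times a root element of H. *)
Lemma short_conj_elem P h a b xi : mul_stable P ->
  (forall xi a b, R xi -> indep a b -> P (X (e a) (xi *: e b))) ->
  (forall lam a, L lam -> P (T lam (e a))) ->
  H h -> R xi -> indep a b -> P (X (h *m e a) (xi *: (h *m e b))).
Proof.
move=> P_mul P_short P_long Hh Rxi ab.
have Pcol g k t : H g -> L t -> P (T t (g *m e k)) by exact: long_conj_elem.
have vv' : B (h *m e b) (xi *: (h *m e a)) = 0.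
  by rewrite BZr H_isometry // Bei ?mulr0 // indepC.
have Hx : H (X (e (s b)) (xi *: e a)) by apply: Rxi; ind.
have gE : h *m e b + xi *: (h *m e a) = (h *m X (e (s b)) (xi *: e a)) *m e b.
  by rewrite -mulmxA Xes 1?indepC // (mulmxDr h) -scalemxAr.
rewrite -XZ XC X_as_T // gE TZ mul1r.
have Lxi : L (xi ^+ 2) by rewrite -[_ ^+ 2]mulr1; apply: LM => //; apply: L1.
have L11 := L1.
by apply: P_mul.2; [apply: P_mul.2; apply: Pcol | apply: Pcol => //; apply: HM].
Qed.

End Coefficients.

(** * Root elements of the symplectic group *)

Lemma form_mx_entry (i j : I) : form_mx A n i j = (j == s i)%:R.
Proof.
rewrite form_mxE; case: (j == s i) => //.
by rewrite /idx_sign; case: ifP => // _; apply: opp2.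
Qed.

Lemma B_form (u v : V) : B u v = (u^T *m form_mx A n *m v) 0 0.
Proof.
rewrite mxE /B (reindex_inj rev_ord_inj); apply: eq_bigr => j _; congr (_ * _).
  rewrite mxE (bigD1 (s j)) //= big1 => [|i ij].
    by rewrite form_mx_entry rev_ordK eqxx mulr1 addr0 mxE.
  by rewrite form_mx_entry -(inj_eq rev_ord_inj) rev_ordK eq_sym (negPf ij) mulr0.
by rewrite rev_ordK.
Qed.

Lemma Sp_isometry (g : Sp A n) : isometry g.
Proof.
move=> u v; rewrite !B_form trmx_mul -!mulmxA (mulmxA _ g) (mulmxA g^T).
by rewrite (mulmxA g^T) SpP mulmxA.
Qed.

Lemma X_delta a b xi :
  X (e a) (xi *: e b) = 1%:M + (xi *: delta_mx a (s b) + xi *: delta_mx b (s a)).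
Proof.
have sC (i j : I) : (s i == j) = (i == s j) by rewrite -(inj_eq rev_ord_inj) rev_ordK.
rewrite /X; congr (_ + (_ + _)); apply/matrixP => i j; rewrite !mxE !crdZ !crd_e sC.
  by case: (i == a); case: (j == s b); rewrite ?(mulr0, mulr1, mul1r, mul0r).
by case: (i == b); case: (j == s a); rewrite ?(mulr0, mulr1, mul1r, mul0r).
Qed.

Lemma T_delta a lam : T lam (e a) = 1%:M + lam *: delta_mx a (s a).
Proof.
have sC (i j : I) : (s i == j) = (i == s j) by rewrite -(inj_eq rev_ord_inj) rev_ordK.
rewrite /T; congr (_ + _); apply/matrixP => i j; rewrite !mxE !crd_e sC.
by case: (i == a); case: (j == s a); rewrite ?(mulr0, mulr1, mul1r, mul0r).
Qed.

Lemma opp2mx (g : M) : - g = g.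
Proof. by apply/matrixP => i j; rewrite mxE opp2. Qed.

Lemma root_mx_short (c : Croot n) : is_short c ->
  exists a b, indep a b /\ forall xi, root_mx c xi = X (e a) (xi *: e b).
Proof.
case: c => // i j ij _.
- exists (pidx i), (nidx j); split=> [|xi].
    by rewrite /indep rev_pidx npidx_eq nidx_eq eq_sym.
  by rewrite X_delta rev_pidx rev_nidx addrA /= opp2mx.
- exists (pidx i), (pidx j); split=> [|xi].
    by rewrite /indep rev_pidx pnidx_eq pidx_eq eq_sym ij.
  by rewrite X_delta !rev_pidx addrA.
- exists (nidx i), (nidx j); split=> [|xi].
    by rewrite /indep rev_nidx npidx_eq nidx_eq eq_sym ij.
  by rewrite X_delta !rev_nidx addrA.
Qed.

Lemma root_mx_long (c : Croot n) : is_long c ->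
  exists a, forall xi, root_mx c xi = T xi (e a).
Proof.
case: c => // k _; [exists (pidx k) | exists (nidx k)] => xi.
  by rewrite T_delta rev_pidx.
by rewrite T_delta rev_nidx.
Qed.

Lemma pn_cases (a : I) : (exists i, a = pidx i) \/ (exists i, a = nidx i).
Proof.
have [i ->|i ->] := split_ordP a; [left | right]; first by exists i.
by exists (rev_ord i); rewrite /nidx rev_ordK.
Qed.

Lemma short_root_of a b : indep a b ->
  exists2 c : Croot n, is_short c & forall xi, root_mx c xi = X (e a) (xi *: e b).
Proof.
move=> /andP[]; case: (pn_cases a) => [] [i ->]; case: (pn_cases b) => [] [j ->];
  rewrite ?rev_pidx ?rev_nidx ?pidx_eq ?nidx_eq eq_sym => ba bsa.
- by exists (eps_add ba) => // xi; rewrite X_delta !rev_pidx addrA.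
- rewrite eq_sym in bsa.
  by exists (eps_sub bsa) => // xi; rewrite X_delta rev_pidx rev_nidx addrA /= opp2mx.
- exists (eps_sub bsa) => // xi; rewrite -XZ XC X_delta rev_pidx rev_nidx addrA /=.
  by rewrite opp2mx.
- by exists (eps_addN ba) => // xi; rewrite X_delta !rev_nidx addrA.
Qed.

Lemma long_root_of a :
  exists2 c : Croot n, is_long c & forall xi, root_mx c xi = T xi (e a).
Proof.
case: (pn_cases a) => [] [i ->]; [exists (eps_dbl i) | exists (eps_dblN i)] => // xi.
  by rewrite T_delta rev_pidx.
by rewrite T_delta rev_nidx.
Qed.

Definition mx_of (G : set (Sp A n)) (g : M) := exists2 x, G x & Sp_mx x = g.

Section Subgroup.
Variable G : set (Sp A n).
Hypothesis G_group : group_closed (mem G).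

Lemma subgroup1 : G 1%g. Proof. by have := G_group.1; rewrite inE. Qed.
Lemma subgroupM x y : G x -> G y -> G (x * y)%g.
Proof. by move=> Gx Gy; have := @group_closedM _ _ G_group x y; rewrite !inE; apply. Qed.
Lemma subgroupV x : G x -> G x^-1%g.
Proof. by move=> Gx; have := @group_closedV _ _ G_group x; rewrite !inE; apply. Qed.

Lemma mx_of_mul_stable : mul_stable (mx_of G).
Proof.
split; first by exists 1%g => //; apply: subgroup1.
by move=> _ _ [x Gx <-] [y Gy <-]; exists (x * y)%g => //; apply: subgroupM.
Qed.

Lemma mx_of_isometry g : mx_of G g -> isometry g.
Proof. by case=> x _ <-; apply: Sp_isometry. Qed.

Lemma mx_of_inv g : mx_of G g -> exists2 h, mx_of G h & g *m h = 1%:M.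
Proof.
case=> x Gx <-; exists (Sp_mx x^-1%g); first by exists x^-1%g => //; apply: subgroupV.
exact: (congr1 (@Sp_mx A n) (mulgV x)).
Qed.

End Subgroup.

Lemma mx_of_mem G x : mx_of G (Sp_mx x) -> G x.
Proof. by case=> y Gy /val_inj <-. Qed.

Section ElementaryGroup.
Variables R L : set A.

Lemma Ep_group : group_closed (mem (Ep n R L)).
Proof.
split; first by rewrite inE => G [G_group _]; apply: subgroup1.
move=> x y; rewrite !inE => Ex Ey G GP; have [G_group _] := GP.
by apply: subgroupM => //; [apply: Ex | apply: subgroupV => //; apply: Ey].
Qed.

Lemma Ep_short a b xi : indep a b -> R xi -> mx_of (Ep n R L) (X (e a) (xi *: e b)).
Proof.
move=> ab Rxi; have [c cs cE] := short_root_of ab.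
exists (root_elt c xi); last exact: cE.
by apply: sub_gen_smallest; left; exists c, xi.
Qed.

Lemma Ep_long a lam : L lam -> mx_of (Ep n R L) (T lam (e a)).
Proof.
move=> Llam; have [c cl cE] := long_root_of a.
exists (root_elt c lam); last exact: cE.
by apply: sub_gen_smallest; right; exists c, lam.
Qed.

Lemma Ep_sub (G : set (Sp A n)) : group_closed (mem G) ->
  (forall a b xi x, indep a b -> R xi -> Sp_mx x = X (e a) (xi *: e b) -> G x) ->
  (forall a lam x, L lam -> Sp_mx x = T lam (e a) -> G x) ->
  Ep n R L `<=` G.
Proof.
move=> G_group G_short G_long; apply: smallest_sub => // x [].
  move=> [c [xi [/root_mx_short[a [b [ab cE]]] Rxi ->]]].
  by apply: (G_short a b xi) => //; apply: cE.
move=> [c [xi [/root_mx_long[a cE] Lxi ->]]].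
by apply: (G_long a xi) => //; apply: cE.
Qed.

End ElementaryGroup.

(** * The form group *)

Section Invariant.
Variables R L : set A.
Hypothesis RL : is_form_ring R L.

Let LR := form_param_sub RL.
Let R0 := form_ring0 RL.
Let R1 := form_ring1 RL.
Let RD := form_ringD RL.
Let RM := form_ringM RL.
Let L0 := form_param0 RL.
Let LD := form_paramD RL.
Let LM := form_paramM RL.

Definition over (v : V) := forall i, R v.@i.

(** The symplectic group of the form ring (R, Lambda), inside Sp_2n(A). *)
Definition form_unitary : set (Sp A n) :=
  [set x | forall v, over v -> over (Sp_mx x *m v) /\ L (q (Sp_mx x *m v) + q v)].

Lemma over_e a : over (e a).
Proof. by move=> i; rewrite crd_e; case: eqP. Qed.

Lemma form_unitary_group : group_closed (mem form_unitary).
Proof.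
split.
  by rewrite inE => v Rv; rewrite [Sp_mx _ *m v]mul1mx add2x; split.
move=> x y; rewrite !inE => Ux Uy v Rv.
have yK w : Sp_mx y *m (Sp_mx y^-1%g *m w) = w.
  by rewrite mulmxA (congr1 (@Sp_mx A n) (mulgV y) : _ *m _ = 1%:M) mul1mx.
have Ry : over (Sp_mx y^-1%g *m v).
  move=> i; rewrite -[i]rev_ordK -Be -(Sp_isometry y) yK.
  apply: (big_ind R) => // j _; apply: RM => //.
  by have [] := Uy _ (over_e (s i)).
have -> : Sp_mx (x / y)%g *m v = Sp_mx x *m (Sp_mx y^-1%g *m v) by rewrite mulmxA.
have [Rxy Lxy] := Ux _ Ry; split=> //.
have [_] := Uy _ Ry; rewrite yK => /(LD Lxy); congr L; ring2.
Qed.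

Lemma Ep_form_unitary : Ep n R L `<=` form_unitary.
Proof.
apply: Ep_sub; first exact: form_unitary_group.
- move=> a b xi x ab Rxi xE v Rv; rewrite xE; split.
    move=> i; rewrite Xv !(crdD, crdZ) BZl !Be !crd_e.
    by apply: RD; [apply: RD|] => //; repeat apply: RM => //; case: eqP.
  rewrite Xv !qD !(BDl, BDr, BZl, BZr) !(qZ, qe) ![B v _]BC !Be.
  rewrite -!Be Bei // !Be; have := L0; congr L; ring2.
- move=> a lam x Llam xE v Rv; rewrite xE; split.
    move=> i; rewrite Tv !(crdD, crdZ) !Be !crd_e.
    by apply: RD => //; apply: RM; [apply: RM => //; apply: LR | case: eqP].
  rewrite Tv qD qZ qe !BZr ![B v _]BC Be.
  have := LM (Rv (s a)) Llam; congr L; ring2.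
Qed.

End Invariant.

Lemma normalizer_sub (E : set (Sp A n)) g x : normalizer E g -> E x -> E (x ^ g)%g.
Proof. by move=> gE Ex; rewrite -[E in E (_)]gE; exists x. Qed.

(** * The sandwich *)

Section Sandwich.
Variables (K : set A) (H : set (Sp A n)).
Hypotheses (Kring : is_subring K) (n_ge3 : (3 <= n)%N).
Hypotheses (H_group : group_closed (mem H)) (EpK_H : Ep n K K `<=` H).

Let mxH := mx_of H.
Let R := short_coeffs mxH.
Let L := long_coeffs mxH.

Let K1 : K 1. Proof. by case: Kring; rewrite inE. Qed.
Let mxH_mul : mul_stable mxH. Proof. exact: mx_of_mul_stable. Qed.

Let mx_of_sub (G G' : set (Sp A n)) g : G `<=` G' -> mx_of G g -> mx_of G' g.
Proof. by move=> GG' [x Gx xg]; exists x => //; apply: GG'. Qed.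

Let mxH_short1 a b : indep a b -> mxH (X (e a) (e b)).
Proof.
move=> ab; rewrite -[e b]scale1r; apply: mx_of_sub EpK_H _; exact: Ep_short.
Qed.

Let mxH_long1 a : mxH (T 1 (e a)).
Proof. by apply: mx_of_sub EpK_H _; apply: Ep_long. Qed.

Lemma sandwich_form_ring : is_form_ring R L.
Proof. exact: coeffs_form_ring. Qed.

Lemma sandwich_K : K `<=` L.
Proof. by move=> k Kk a; apply: mx_of_sub EpK_H _; apply: Ep_long. Qed.

Lemma sandwich_lower : Ep n R L `<=` H.
Proof.
apply: Ep_sub => // [a b xi x ab Rxi xE | a lam x Llam xE]; apply: mx_of_mem.
  by rewrite xE; apply: Rxi.
by rewrite xE; apply: Llam.
Qed.

(** Conjugation by g replaces the basis vectors in a generator by columns of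
    g^-1, and g^-1 lies in H as well. *)
Lemma conj_Ep g : H g -> forall x, Ep n R L x -> Ep n R L (x ^ g)%g.
Proof.
move=> Hg; pose G := [set x | Ep n R L (x ^ g)%g] : set (Sp A n).
have Hgv : mxH (Sp_mx g^-1%g) by exists g^-1%g => //; apply: subgroupV.
have gE (x : Sp A n) : Sp_mx (x ^ g)%g = Sp_mx g^-1%g *m Sp_mx x *m Sp_mx g.
  by rewrite -mulmxA.
have gK : Sp_mx g^-1%g *m Sp_mx g = 1%:M by exact: (congr1 (@Sp_mx A n) (mulVg g)).
have E_group := @Ep_group R L.
suff : Ep n R L `<=` G by [].
apply: Ep_sub.
- split; first by rewrite inE /G /= conj1g; apply: subgroup1.
  move=> x y; rewrite !inE /G /= => Ex Ey; rewrite conjMg conjVg.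
  by apply: (subgroupM E_group) => //; apply: (subgroupV E_group).
- move=> a b xi x ab Rxi xE; apply: (@mx_of_mem (Ep n R L)); rewrite gE xE.
  rewrite (isometry_X _ _ (Sp_isometry _)) -mulmxA gK mulmx1 -scalemxAr.
  apply: (short_conj_elem n_ge3 mxH_mul mxH_short1 mxH_long1) => //.
  + exact: mx_of_isometry.
  + exact: mx_of_inv.
  + exact: mx_of_mul_stable.
  + by move=> *; apply: Ep_short.
  + by move=> *; apply: Ep_long.
- move=> a lam x Llam xE; apply: (@mx_of_mem (Ep n R L)); rewrite gE xE.
  rewrite (isometry_T _ _ (Sp_isometry _)) -mulmxA gK mulmx1.
  apply: (long_conj_elem n_ge3 mxH_mul mxH_short1 mxH_long1) => //.
  + exact: mx_of_isometry.
  + exact: mx_of_inv.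
  + exact: mx_of_mul_stable.
  + by move=> *; apply: Ep_short.
  + by move=> *; apply: Ep_long.
Qed.

Lemma sandwich_upper : H `<=` normalizer (Ep n R L).
Proof.
move=> g Hg; apply/seteqP; split=> [_ [x Ex <-]|x Ex]; first exact: conj_Ep.
exists (x ^ g^-1)%g; last by rewrite conjgKV.
by apply: conj_Ep => //; apply: subgroupV.
Qed.

(** A root element g of H and y over F_2 in E' = Ep(R', Lambda') have
    g y g y in E', because H normalizes E'.  For suitable y this product maps a
    basis vector to one that shows the parameter of g as a coordinate (short
    roots) or as its value under q (long roots). *)
Lemma sandwich_unique (R' L' : set A) :
  is_form_ring R' L' -> Ep n R' L' `<=` H -> H `<=` normalizer (Ep n R' L') ->
  (R, L) = (R', L').
Proof.
move=> RL' lower upper.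
have R'1 : R' 1 by case: RL' => [[]]; rewrite inE.
have E_mul := mx_of_mul_stable (@Ep_group R' L').
have conj_E g y : g *m g = 1%:M -> mxH g -> mx_of (Ep n R' L') y ->
    mx_of (Ep n R' L') (g *m (y *m g *m y)).
  move=> gg [x Hx xg] Ey; rewrite !mulmxA; apply: E_mul.2 => //; case: Ey => z Ez <-.
  exists (z ^ x)%g; first exact: normalizer_sub (upper _ Hx) Ez.
  have xVg : Sp_mx x^-1%g = g.
    rewrite -[LHS]mulmx1 -gg -{1}xg mulmxA.
    by rewrite (congr1 (@Sp_mx A n) (mulVg x) : _ *m _ = 1%:M) mul1mx.
  have -> : Sp_mx (z ^ x)%g = Sp_mx x^-1%g *m (Sp_mx z *m Sp_mx x) by [].
  by rewrite xVg xg mulmxA.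
have unitary g (gE : mx_of (Ep n R' L') g) v : over R' v ->
    over R' (g *m v) /\ L' (q (g *m v) + q v).
  by case: gE => z Ez <-; apply: (Ep_form_unitary RL' Ez).
congr (_, _); apply/seteqP; split=> x.
- move=> Rx.
  have [a [b [c [ab ac bc]]]] : exists a b c, [/\ indep a b, indep a c & indep b c].
    pose a := pidx (Ordinal (ltnW (ltnW n_ge3))).
    have [b [ab _]] := third_index n_ge3 a a.
    by have [c [ac bc]] := third_index n_ge3 a b; exists a, b, c.
  have gB : B (e a) (x *: e c) = 0 by rewrite BZr Bei ?mulr0.
  have Ey : mx_of (Ep n R' L') (X (e (s c)) (1 *: e b)).
    by apply: Ep_short => //; rewrite indepsl indepC.
  have cb : indep c b by rewrite indepC.
  have := conj_E _ _ (XX gB) (Rx a c ac) Ey.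
  rewrite X_commutator // mulr1 => /unitary/(_ _ (over_e RL' (s b)))[/(_ a) + _].
  rewrite Xv BZl Be !(crdD, crdZ) !crd_e !eqxx.
  have ba : indep b a by rewrite indepC.
  have /andP[/negPf-> _] := ba; have := ba; rewrite -indepsl => /andP[/negPf-> _].
  by rewrite !mulr1 !mulr0 addr0 add0r.
- by move=> R'x a b ab; apply: mx_of_sub lower _; apply: Ep_short.
- move=> Lx.
  pose a := pidx (Ordinal (ltnW (ltnW n_ge3))).
  have [b [ab _]] := third_index n_ge3 a a.
  have Ey : mx_of (Ep n R' L') (X (e (s b)) (1 *: e a)).
    by apply: Ep_short => //; rewrite indepsl indepC.
  have := conj_E _ _ (TT x (e b)) (Lx b) Ey.
  rewrite T_commutator // expr1n !mulr1 => /unitary/(_ _ (over_e RL' (s a)))[_].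
  rewrite -mulmxA Xv Tv BZl !BDr !BZr Bers Bvv Bei ?indepsr 1?indepC //.
  rewrite Bei // !qD !qZ !qe !(BDl, BZl, BDr, BZr) Beslr.
  rewrite !(mulr0, addr0, add0r, mulr1, mul0r, scale0r). 
  by rewrite (@Bei (s a)) ?indepsl // (@Bei b) 1?indepC // !mulr0 add0r addr0.
- by move=> L'x a; apply: mx_of_sub lower _; apply: Ep_long.
Qed.

End Sandwich.

End CharacteristicTwo.

Theorem theorem1 (A : comPzRingType) (n : nat) (K : set A) (H : set (Sp A n))
  (A2 : 2%:R = 0 :> A) (Kring : is_subring K) (n_ge3 : (3 <= n)%N)
  (Hgroup : group_closed (mem H)) (EpK_H : Ep n K K `<=` H) :
  exists! RL : set A * set A,
    let: (R, L) := RL in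
    [/\ is_form_ring R L, K `<=` L, L `<=` R,
        Ep n R L `<=` H & H `<=` normalizer (Ep n R L)].
Proof.
exists (short_coeffs (mx_of H), long_coeffs (mx_of H)); split.
  have RL := sandwich_form_ring A2 Kring n_ge3 Hgroup EpK_H.
  split=> //.
  - exact: sandwich_K.
  - by case: RL => _ [].
  - exact: sandwich_lower.
  - exact: (sandwich_upper A2 Kring n_ge3 Hgroup EpK_H).
case=> R L [RL _ _ lower upper].
exact: (sandwich_unique A2 n_ge3 RL lower upper).
Qed.
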